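(* Let $(\mathbf{C},I)$ be a predicate-separated $\sigma$-effectus with scalars $\mathbf{C}(I,I)\cong[0,1]$. Then there is a faithful morphism of $\sigma$-effectuses $F\colon\mathbf{C}\to\boldsymbol{\sigma}\mathbf{BOUS}^{\mathrm{op}}$. Furthermore, $\mathrm{Pred}(A)\cong[0,u]_{FA}$ (as $\sigma$-effect $[0,1]$-modules) for all $A\in\mathbf{C}$, where $u$ is the order unit of $FA$.
   Context: Countable means finite (possibly empty) or countably infinite. A partial commutative monoid (PCM) is a set $X$ with $0\in X$ and a partial binary operation $\oplus$ with $(x\oplus y)\oplus z=x\oplus(y\oplus z)$, $x\oplus y=y\oplus x$, $0\oplus x=x$, where ''$=$'' is Kleene equality (if either side is defined, so is the other, and they are equal); $x\perp y$ means $x\oplus y$ is defined. An effect algebra is a PCM $E$ with an element $1\in E$ such that for each $a\in E$ there is a unique $a^{\perp}\in E$ with $a\oplus a^{\perp}=1$, and $a\perp 1$ implies $a=0$; it is partially ordered by $a\le b$ iff $a\oplus c=b$ for some $c$. A $\sigma$-PAM is a nonempty set $M$ with a partial operation $\bigoplus$ sending countable families $(x_j)_{j\in J}$ in $M$ to elements of $M$ (a family is summable if its sum is defined), such that: (partition-associativity) for each countable family $(x_j)_{j\in J}$ and countable partition $J=\biguplus_{k\in K}J_k$, the family is summable iff each $(x_j)_{j\in J_k}$ is summable and $(\bigoplus_{j\in J_k}x_j)_{k\in K}$ is summable, and then $\bigoplus_{j\in J}x_j=\bigoplus_{k\in K}\bigoplus_{j\in J_k}x_j$; (unary sum) one-element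 families are summable with sum their element; (limit) a countable family is summable whenever all its finite subfamilies are. A $\sigma$-PAM is a PCM with $x_1\oplus x_2=\bigoplus_{i\in\{1,2\}}x_i$ and $0=\bigoplus\emptyset$. A map between $\sigma$-PAMs is $\sigma$-additive if it sends summable families to summable families and preserves their sums; $\sigma$-biadditive means $\sigma$-additive in each argument. A $\sigma$-PAC is a category $\mathbf{C}$ with countable coproducts (coprojections $\kappa_i$), all of whose homsets are $\sigma$-PAMs with $\sigma$-biadditive composition (so there are zero morphisms $0_{AB}$), such that: (compatible sum) every compatible countable family $(f_j\colon A\to B)_{j\in J}$ is summable in $\mathbf{C}(A,B)$; (untying) if $f,g\colon A\to B$ are summable then so are $\kappa_1\circ f,\kappa_2\circ g\colon A\to B+B$. Here $(f_j\colon A\to B_j)_{j\in J}$ is compatible if there is $f\colon A\to\coprod_{j}B_j$ with $\triangleright_j\circ f=f_j$ for all $j$, where the partial projection $\triangleright_i\colon\coprod_jB_j\to B_i$ is determined by $\triangleright_i\circ\kappa_i=\mathrm{id}$ and $\triangleright_i\circ\kappa_k=0$ for $k\ne i$. A $\sigma$-effectus is a $\sigma$-PAC $\mathbf{C}$ with a distinguished object $I$ such that: (i) for each $A$, the PCM $\mathbf{C}(A,I)$ is an effect algebra, with top written $\mathbf{1}_A$; (ii) $\mathbf{1}_B\circ f=0_{AI}$ implies $f=0_{AB}$ for all $f\colon A\to B$; (iii) $\mathbf{1}_B\circ f\perp\mathbf{1}_B\circ g$ implies $f\perp g$ for all $f,g\colon A\to B$. A morphism of $\sigma$-effectuses $(\mathbf{C},I_{\mathbf{C}})\to(\mathbf{D},I_{\mathbf{D}})$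 is a functor $F\colon\mathbf{C}\to\mathbf{D}$ that preserves countable coproducts and for which there is an isomorphism $u\colon I_{\mathbf{D}}\to FI_{\mathbf{C}}$ with $F\mathbf{1}_A=u\circ\mathbf{1}_{FA}$ for each $A\in\mathbf{C}$; it is called faithful if it is faithful as a functor. $\mathrm{Pred}(A)=\mathbf{C}(A,I)$. The $\sigma$-effectus is predicate-separated if for any $f,g\colon A\to B$ one has $f=g$ whenever $p\circ f=p\circ g$ for all $p\in\mathrm{Pred}(B)$. The scalars $\mathbf{C}(I,I)$ form an effect monoid (an effect algebra with an associative, unital (with unit $1$), biadditive total multiplication) under composition, and $\mathbf{C}(I,I)\cong[0,1]$ means isomorphism of effect monoids, $[0,1]$ having ordinary multiplication and addition defined when the sum is $\le1$. A $\sigma$-effect algebra is an effect algebra in which every increasing sequence has a supremum; a countable family is summable iff all its finite subfamilies are, and then $\bigoplus_{j\in J}x_j=\bigvee_{F\subseteq J\text{ finite}}\bigoplus_{j\in F}x_j$. A $\sigma$-effect $[0,1]$-module is a $\sigma$-effect algebra $E$ with a $\sigma$-biadditive monoid action $[0,1]\times E\to E$; isomorphisms are bijections preserving and reflecting all this structure. $\mathrm{Pred}(A)$ is a $\sigma$-effect $[0,1]$-module via $r\cdot p=r\circ p$ (identifying scalars with $[0,1]$). An order unit of an ordered real vector space $A$ is $u\ge0$ such that for all $x\in A$ there is $n\in\mathbb{N}$ with $-nu\le x\le nu$. An order-unit space is an ordered vector space with order unit $u$ such that $nx\le u$ for all $n\in\mathbb{N}$ implies $x\le0$; its norm is $\|a\|=\inf\{r>0\mid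 -ru\le a\le ru\}$; it is Banach if complete in this norm. It is monotone $\sigma$-complete if every increasing sequence that is bounded above has a supremum. $\boldsymbol{\sigma}\mathbf{BOUS}$ is the category of monotone $\sigma$-complete Banach order-unit spaces, with morphisms the positive linear maps $f$ that are subunital ($f(u_A)\le u_B$) and $\sigma$-normal (preserve suprema of increasing sequences that are bounded above). $[0,u]_A=\{a\in A\mid0\le a\le u\}$, with addition defined when the sum is $\le u$ and with the evident scalar multiplication, is a $\sigma$-effect $[0,1]$-module. $\boldsymbol{\sigma}\mathbf{BOUS}^{\mathrm{op}}$ is a $\sigma$-effectus with unit object $(\mathbb{R},1)$; $\mathbf{1}_A$ corresponds to the map $\mathbb{R}\to A$, $r\mapsto ru$, and a countable family of parallel maps $f_j\colon B\to A$ in $\boldsymbol{\sigma}\mathbf{BOUS}$ is summable iff $\sum_{j\in F}f_j(u_B)\le u_A$ for all finite $F$. *)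

(* Defs.v *)
From HB Require Import structures.
From mathcomp Require Import all_boot all_order all_algebra finmap.
From mathcomp Require Import boolp classical_sets reals.
From mathcomp Require Import lra.

Set Implicit Arguments.
Unset Strict Implicit.
Unset Printing Implicit Defensive.

Import Order.TTheory GRing.Theory Num.Theory.

Local Open Scope classical_set_scope.
Local Open Scope ring_scope.

Record category := Category {
  ob :> Type;
  mor : ob -> ob -> Type;
  mid : forall A, mor A A;
  mcomp : forall A B C, mor B C -> mor A B -> mor A C;
  mcomp_idl : forall A B (f : mor A B), mcomp (mid B) f = f;
  mcomp_idr : forall A B (f : mor A B), mcomp f (mid A) = f;
  mcompA : forall A B C D (h : mor C D) (g : mor B C) (f : mor A B),
    mcomp h (mcomp g f) = mcomp (mcomp h g) f
}.

Arguments mor {c} A B.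
Arguments mid {c} A.
Arguments mcomp {c A B C} g f.

Notation "g '\oc' f" := (mcomp g f) (at level 50, left associativity).

Definition op (C : category) : category :=
  @Category C (fun A B => @mor C B A) (@mid C) (fun _ _ _ g f => f \oc g)
    (fun _ _ f => mcomp_idr f) (fun _ _ f => mcomp_idl f)
    (fun _ _ _ _ h g f => esym (mcompA f g h)).

Record functor (C D : category) := Functor {
  fob :> C -> D;
  fmap : forall A B : C, mor A B -> mor (fob A) (fob B);
  fmap_id : forall A, fmap (mid A) = mid (fob A);
  fmap_comp : forall (A B E : C) (g : mor B E) (f : mor A B),
    fmap (g \oc f) = fmap g \oc fmap f
}.

Definition faithful (C D : category) (F : functor C D) :=
  forall A B : C, injective (@fmap C D F A B).

Definition is_iso (C : category) (A B : C) (f : mor A B) :=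
  exists g : mor B A, g \oc f = mid A /\ f \oc g = mid B.

Definition is_coproduct (C : category) (J : Type) (B : J -> C) (S : C)
    (k : forall j, mor (B j) S) :=
  forall (X : C) (f : forall j, mor (B j) X),
    exists! h : mor S X, forall j, h \oc k j = f j.

Definition preserves_countable_coproducts (C D : category) (F : functor C D) :=
  forall (J : countType) (B : J -> C) (S : C) (k : forall j, mor (B j) S),
    is_coproduct k -> is_coproduct (fun j => fmap F (k j)).

Record countable_coproducts (C : category) := CountableCoproducts {
  coprod : forall J : countType, (J -> C) -> C;
  kappa : forall (J : countType) (B : J -> C) (j : J), mor (B j) (coprod B);
  kappaP : forall (J : countType) (B : J -> C), is_coproduct (@kappa J B)
}.

Arguments kappa {C} c {J B} j.

(* A countable family is a function on a [countType].  A decomposition of [J]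
   into blocks indexed by [K] is a map [p : J -> K] with the fibres as blocks,
   so blocks may be empty.  Partial operations are [option]-valued, which
   makes Leibniz equality Kleene equality. *)
Record sigmaPAM (M : Type) := SigmaPAM {
  psum : forall J : countType, (J -> M) -> option M;
  psum_inhabited : inhabited M;
  psum_partition : forall (J K : countType) (p : J -> K) (x : J -> M) (s : M),
    psum x = Some s <->
    exists y : K -> M,
      (forall k, psum (fun j : {j : J | p j == k} => x (val j)) = Some (y k))
      /\ psum y = Some s;
  psum_unary : forall (J : countType) (j0 : J) (x : J -> M),
    (forall j, j = j0) -> psum x = Some (x j0);
  psum_limit : forall (J : countType) (x : J -> M),
    (forall F : {fset J}, isSome (psum (fun j : F => x (val j)))) ->
    isSome (psum x)
}.

Arguments psum {M} s {J} x : rename.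

Section PAMTheory.
Context (M : Type) (S : sigmaPAM M).

Definition summable (J : countType) (x : J -> M) : bool := isSome (psum S x).

Definition padd (x y : M) : option M :=
  psum S (fun i : bool => if i then x else y).

Definition perp (x y : M) : bool := isSome (padd x y).

Lemma psum_void : {z : M | psum S (of_void M) = Some z}.
Proof.
apply: cid; have [m] := psum_inhabited S.
have sm : psum S (fun _ : unit => m) = Some m.
  by apply: (@psum_unary _ S _ tt (fun=> m)); case.
have [y [+ _]] := (psum_partition S (fun=> true) _ _).1 sm => /(_ false).
pose E : countType := {j : unit | true == false}; move=> sE.
pose p (j : E) : void := match notF (valP j) with end.
have [z [_ sz]] := (psum_partition S p _ _).1 sE.
by exists (y false); rewrite -sz; congr psum; apply/funext; case.
Qed.

Definition pzero : M := sval psum_void.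

End PAMTheory.

Definition sigma_additive (M N : Type) (S : sigmaPAM M) (T : sigmaPAM N)
    (f : M -> N) :=
  forall (J : countType) (x : J -> M) (s : M),
    psum S x = Some s -> psum T (f \o x) = Some (f s).

Section PartialProjections.
Context (C : category) (cc : countable_coproducts C).
Context (pam : forall A B : C, sigmaPAM (mor A B)).

Definition cotuple (J : countType) (B : J -> C) (X : C)
    (f : forall j, mor (B j) X) : mor (coprod cc B) X :=
  sval (cid (kappaP cc f)).

(* The transport along [e : k = i] makes [mid (B k)] a map into [B i]. *)
Definition kdelta (J : countType) (B : J -> C) (i k : J) : mor (B k) (B i) :=
  match k =P i with
  | ReflectT e => ecast z (mor (B k) (B z)) e (mid (B k))
  | ReflectF _ => pzero (pam (B k) (B i))
  end.

Definition pproj (J : countType) (B : J -> C) (i : J) :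
    mor (coprod cc B) (B i) :=
  cotuple (kdelta B i).

Lemma pproj_kappa (J : countType) (B : J -> C) (i : J) :
  pproj B i \oc kappa cc i = mid (B i).
Proof.
rewrite /pproj /cotuple; case: cid => h [/= -> _]; rewrite /kdelta.
by case: eqP => // e; rewrite (eq_axiomK e).
Qed.

Lemma pproj_kappa_neq (J : countType) (B : J -> C) (i k : J) :
  k <> i -> pproj B i \oc kappa cc k = pzero (pam (B k) (B i)).
Proof.
move=> ki; rewrite /pproj /cotuple; case: cid => h [/= -> _]; rewrite /kdelta.
by case: eqP.
Qed.

Definition compatible (J : countType) (A : C) (B : J -> C)
    (f : forall j, mor A (B j)) :=
  exists g : mor A (coprod cc B), forall j, pproj B j \oc g = f j.

End PartialProjections.

Record sigmaPAC := SigmaPAC {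
  pac_cat :> category;
  pac_coprod : countable_coproducts pac_cat;
  pac_pam : forall A B : pac_cat, sigmaPAM (mor A B);
  pac_comp_additivel : forall (A B D : pac_cat) (f : mor A B),
    sigma_additive (pac_pam B D) (pac_pam A D) (fun g => g \oc f);
  pac_comp_additiver : forall (A B D : pac_cat) (g : mor B D),
    sigma_additive (pac_pam A B) (pac_pam A D) (fun f => g \oc f);
  pac_compatible_sum : forall (J : countType) (A B : pac_cat) (f : J -> mor A B),
    compatible pac_coprod pac_pam (B := fun=> B) f ->
    summable (pac_pam A B) f;
  pac_untying : forall (A B : pac_cat) (f g : mor A B),
    perp (pac_pam A B) f g ->
    perp (pac_pam A (coprod pac_coprod (fun _ : bool => B)))
      (kappa pac_coprod true \oc f) (kappa pac_coprod false \oc g)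
}.

Record effect_sig := EffectSig {
  ecar :> Type;
  eadd : ecar -> ecar -> option ecar;
  ezero : ecar;
  eone : ecar
}.

Arguments ezero {e}.
Arguments eone {e}.

Record is_effect_algebra (E : effect_sig) : Prop := IsEffectAlgebra {
  eaddA : forall x y z : E,
    obind (fun t => eadd t z) (eadd x y) = obind (eadd x) (eadd y z);
  eaddC : forall x y : E, eadd x y = eadd y x;
  eadd0 : forall x : E, eadd ezero x = Some x;
  eperp : forall a : E, exists! b : E, eadd a b = Some eone;
  eperp1 : forall a : E, isSome (eadd a eone) -> a = ezero
}.

Section EffectOrder.
Context (E : effect_sig).

Definition ele (a b : E) := exists c, eadd a c = Some b.

Definition efsum (s : seq E) : option E :=
  foldr (fun a => obind (eadd a)) (Some ezero) s.

(* A family is summable when all its finite subfamilies are, and its sum is the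
   supremum of the finite partial sums. *)
Definition is_ecsum (J : countType) (x : J -> E) (s : E) :=
  let part (F : {fset J}) := efsum [seq x j | j <- enum_fset F] in
  [/\ forall F, isSome (part F),
      forall F t, part F = Some t -> ele t s
    & forall b, (forall F t, part F = Some t -> ele t b) -> ele s b].

End EffectOrder.

Record is_effect_iso (E E' : effect_sig) (f : E -> E') : Prop := IsEffectIso {
  eiso_bij : bijective f;
  eiso_add : forall a b, eadd (f a) (f b) = omap f (eadd a b);
  eiso_zero : f ezero = ezero;
  eiso_one : f eone = eone
}.

Record effect_monoid_sig := EffectMonoidSig {
  em_ea :> effect_sig;
  emul : em_ea -> em_ea -> em_ea
}.

Record is_effect_monoid_iso (E E' : effect_monoid_sig) (f : E -> E') : Prop :=
  IsEffectMonoidIso {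
  emiso_effect : is_effect_iso f;
  emiso_mul : forall a b, f (emul a b) = emul (f a) (f b)
}.

(* Addition is defined exactly when the sum lands in the interval again;
   nonnegativity of the sum is automatic in an ordered group. *)
Section Interval.
Context (V : porderZmodType) (u : V) (u_ge0 : 0 <= u).

Definition interval := {a : V | 0 <= a <= u}.

Lemma interval0P : 0 <= (0 : V) <= u. Proof. by rewrite lexx. Qed.
Lemma intervaluP : 0 <= u <= u. Proof. by rewrite u_ge0 lexx. Qed.

Definition interval_effect : effect_sig :=
  @EffectSig interval (fun a b => insub (val a + val b))
    (exist _ 0 interval0P) (exist _ u intervaluP).

End Interval.

Section UnitInterval.
Context (R : realType).

Lemma unit_interval_mulP (r s : interval (1 : R)) :
  0 <= val r * val s <= 1.
Proof.
case: r s => [r /= /andP[r0 r1]] [s /= /andP[s0 s1]].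
by rewrite mulr_ge0 // mulr_ile1.
Qed.

Definition unit_interval : effect_monoid_sig :=
  @EffectMonoidSig (interval_effect (ler01 : 0 <= (1 : R)))
    (fun r s => exist _ (val r * val s) (unit_interval_mulP r s)).

End UnitInterval.

Record effect_module_sig (R : realType) := EffectModuleSig {
  emod_ea :> effect_sig;
  eact : unit_interval R -> emod_ea -> emod_ea
}.

(* The last two fields follow from the first, since the order and the countable
   sums are determined by the addition. *)
Record is_effect_module_iso (R : realType) (E E' : effect_module_sig R)
    (f : E -> E') : Prop := IsEffectModuleIso {
  emodiso_effect : is_effect_iso f;
  emodiso_act : forall r a, f (eact r a) = eact r (f a);
  emodiso_le : forall a b, ele (f a) (f b) <-> ele a b;
  emodiso_csum : forall (J : countType) (x : J -> E) (s : E),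
    is_ecsum (f \o x) (f s) <-> is_ecsum x s
}.

(* The part of a sigma-effectus that the notion of morphism of sigma-effectuses
   refers to: the category, the unit object [I] and the tops [1_A] of the
   effect algebras [mor A I]. *)
Record truth_category := TruthCategory {
  tc_cat :> category;
  tc_unit : tc_cat;
  tc_truth : forall A : tc_cat, mor A tc_unit
}.

Arguments tc_truth {t} A.

Record sigmaEffectus := SigmaEffectus {
  eff_pac :> sigmaPAC;
  eff_unit : eff_pac;
  truth : forall A : eff_pac, mor A eff_unit;
  eff_effect_algebra : forall A : eff_pac,
    is_effect_algebra
      (@EffectSig (mor A eff_unit) (padd (pac_pam A eff_unit))
         (pzero (pac_pam A eff_unit)) (truth A));
  eff_zero : forall (A B : eff_pac) (f : mor A B),
    truth B \oc f = pzero (pac_pam A eff_unit) -> f = pzero (pac_pam A B);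
  eff_perp : forall (A B : eff_pac) (f g : mor A B),
    perp (pac_pam A eff_unit) (truth B \oc f) (truth B \oc g) ->
    perp (pac_pam A B) f g
}.

Arguments truth {s} A.

Definition eff_truth_category (C : sigmaEffectus) : truth_category :=
  @TruthCategory C (eff_unit C) (@truth C).
Coercion eff_truth_category : sigmaEffectus >-> truth_category.

Definition is_effectus_morphism (C D : truth_category) (F : functor C D) :=
  preserves_countable_coproducts F /\
  exists u : mor (tc_unit D) (F (tc_unit C)),
    is_iso u /\ forall A : C, fmap F (tc_truth A) = u \oc tc_truth (F A).

Section Predicates.
Context (C : sigmaEffectus).

Definition pred_effect (A : C) : effect_sig :=
  @EffectSig (mor A (eff_unit C)) (padd (pac_pam A (eff_unit C)))
    (pzero (pac_pam A (eff_unit C))) (truth A).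

Definition predicate_separated :=
  forall (A B : C) (f g : mor A B),
    (forall p : pred_effect B, p \oc f = p \oc g) -> f = g.

Definition scalars : effect_monoid_sig :=
  @EffectMonoidSig (pred_effect (eff_unit C))
    (fun s t : mor (eff_unit C) (eff_unit C) => s \oc t).

(* [theta] identifies the scalars with the unit interval. *)
Definition pred_module (R : realType) (theta : unit_interval R -> scalars)
    (A : C) : effect_module_sig R :=
  @EffectModuleSig R (pred_effect A)
    (fun r (p : mor A (eff_unit C)) =>
       (theta r : mor (eff_unit C) (eff_unit C)) \oc p).

End Predicates.

HB.mixin Record isOrderedLmodule (R : numDomainType) V
    of GRing.Lmodule R V & Num.POrderedZmodule V := {
  ordlmod_leD : forall z x y : V, x <= y -> z + x <= z + y;
  ordlmod_scale_ge0 : forall (a : R) (x : V), 0 <= a -> 0 <= x -> 0 <= a *: x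
}.

#[short(type="ordLmodType")]
HB.structure Definition OrderedLmodule (R : numDomainType) :=
  {V of GRing.Lmodule R V & Num.POrderedZmodule V & isOrderedLmodule R V}.

HB.mixin Record isOrderUnitSpace (R : realType) V of OrderedLmodule R V := {
  ounit : V;
  ounit_ge0 : 0 <= ounit;
  ounitP : forall x : V, exists n : nat, - (ounit *+ n) <= x <= ounit *+ n;
  ounit_archi : forall x : V, (forall n : nat, x *+ n <= ounit) -> x <= 0
}.

#[short(type="orderUnitSpaceType")]
HB.structure Definition OrderUnitSpace (R : realType) :=
  {V of isOrderUnitSpace R V & OrderedLmodule R V}.

Definition ounorm (R : realType) (V : orderUnitSpaceType R) (a : V) : R :=
  inf [set r : R | 0 < r /\ - (r *: ounit) <= a <= r *: ounit].

HB.mixin Record isSigmaBOUS (R : realType) V of OrderUnitSpace R V := {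
  bous_complete : forall x : nat -> V,
    (forall e : R, 0 < e -> exists N, forall m n, (N <= m)%N -> (N <= n)%N ->
       ounorm (x m - x n) < e) ->
    exists l : V, forall e : R, 0 < e -> exists N, forall n, (N <= n)%N ->
       ounorm (x n - l) < e;
  bous_sigma_complete : forall x : nat -> V,
    {homo x : m n / (m <= n)%N >-> m <= n} -> has_ubound (range x) ->
    exists s, supremums (range x) s
}.

#[short(type="sigmaBOUSType")]
HB.structure Definition SigmaBOUS (R : realType) :=
  {V of isSigmaBOUS R V & OrderUnitSpace R V}.

Record is_bous_hom (R : realType) (A B : sigmaBOUSType R) (f : A -> B) : Prop :=
  IsBousHom {
  bous_linear : linear f;
  bous_positive : forall a, 0 <= a -> 0 <= f a;
  bous_subunital : f ounit <= ounit;
  bous_sigma_normal : forall (x : nat -> A) (s : A),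
    {homo x : m n / (m <= n)%N >-> m <= n} -> has_ubound (range x) ->
    supremums (range x) s -> supremums (range (f \o x)) (f s)
}.

Record bous_hom (R : realType) (A B : sigmaBOUSType R) := BousHom {
  bous_fun :> A -> B;
  bous_homP : is_bous_hom bous_fun
}.

Section BousCategory.
Context (R : realType).
Implicit Types A B D : sigmaBOUSType R.

Lemma bous_hom_ext A B (f g : bous_hom A B) : bous_fun f = bous_fun g -> f = g.
Proof.
case: f g => f fP [g gP] /= e; case: _ / e gP => gP.
by congr BousHom; exact: Prop_irrelevance.
Qed.

Lemma bous_idP A : is_bous_hom (@id A).
Proof. by split. Qed.

Lemma bous_le A B (f : bous_hom A B) : {homo f : x y / x <= y}.
Proof.
move=> x y xy; have [lf pf _ _] := bous_homP f.
have /pf : 0 <= y - x by rewrite -(subrr x) addrC [leRHS]addrC ordlmod_leD.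
have -> : f (y - x) = f y - f x by rewrite addrC -scaleN1r lf scaleN1r addrC.
by move=> /(ordlmod_leD (f x)); rewrite addr0 addrC subrK.
Qed.

Lemma bous_compP A B D (g : bous_hom B D) (f : bous_hom A B) :
  is_bous_hom (g \o f).
Proof.
have [lf pf uf nf] := bous_homP f; have [lg pg ug ng] := bous_homP g.
split=> [a x y|a /pf/pg //||x s xi xb xs] /=.
- by rewrite lf lg.
- by apply: le_trans ug; exact: bous_le.
- have fxs := nf x s xi xb xs; apply: (ng (f \o x) (f s)) => //.
    by move=> m n mn; apply/bous_le/xi.
  by exists (f s); case: fxs.
Qed.

Definition bous_id A : bous_hom A A := BousHom (bous_idP A).

Definition bous_comp A B D (g : bous_hom B D) (f : bous_hom A B) :
  bous_hom A D := BousHom (bous_compP g f).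

Lemma bous_comp_idl A B (f : bous_hom A B) : bous_comp (bous_id B) f = f.
Proof. exact: bous_hom_ext. Qed.

Lemma bous_comp_idr A B (f : bous_hom A B) : bous_comp f (bous_id A) = f.
Proof. exact: bous_hom_ext. Qed.

Lemma bous_compA A B D E (h : bous_hom D E) (g : bous_hom B D)
    (f : bous_hom A B) :
  bous_comp h (bous_comp g f) = bous_comp (bous_comp h g) f.
Proof. exact: bous_hom_ext. Qed.

Definition sigmaBOUS : category :=
  @Category (sigmaBOUSType R) (@bous_hom R) bous_id bous_comp
    bous_comp_idl bous_comp_idr bous_compA.

End BousCategory.

HB.instance Definition _ (R : realType) := Num.POrderedZmodule.on R^o.

Section RealLine.
Context (R : realType).

Lemma real_leD (z x y : R^o) : x <= y -> z + x <= z + y.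
Proof. by rewrite lerD2l. Qed.

Lemma real_scale_ge0 (a : R) (x : R^o) : 0 <= a -> 0 <= x -> 0 <= a *: x.
Proof. exact: mulr_ge0. Qed.

HB.instance Definition _ :=
  isOrderedLmodule.Build R R^o real_leD real_scale_ge0.

Lemma real_unitP (x : R^o) :
  exists n : nat, - ((1 : R^o) *+ n) <= x <= (1 : R^o) *+ n.
Proof.
exists (Num.bound `|x : R|); apply/andP.
by have /ltW := archi_boundP (normr_ge0 (x : R)); rewrite ler_norml => /andP.
Qed.

Lemma real_archi (x : R^o) : (forall n : nat, x *+ n <= (1 : R^o)) -> x <= 0.
Proof.
move=> xn; rewrite leNgt; apply/negP => x0.
have := archi_boundP (ltW (_ : 0 < (x : R)^-1)); rewrite invr_gt0 => /(_ x0).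
rewrite -(ltr_pM2l x0) divff ?gt_eqF // mulr_natr.
by rewrite ltNge xn.
Qed.

HB.instance Definition _ :=
  isOrderUnitSpace.Build R R^o (ler01 : 0 <= (1 : R^o)) real_unitP real_archi.

Lemma real_ounormE (x : R^o) : ounorm x = `|x : R|.
Proof.
rewrite /ounorm.
have -> : [set r : R | 0 < r /\ - (r *: (ounit : R^o)) <= x <= r *: ounit]
        = [set r : R | 0 < r /\ `|x : R| <= r].
  apply/seteqP; split=> r /= [r0]; rewrite ler_norml.
    by rewrite /GRing.scale /= mulr1.
  by rewrite /GRing.scale /= mulr1.
set A := [set r : R | _]; apply/eqP; rewrite eq_le; apply/andP; split.
  apply/ler_addgt0Pr => e e0; apply: ge_inf.
    by exists 0 => r [/ltW].
  split; first by rewrite ltr_wpDl.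
  by rewrite lerDl ltW.
apply: lb_le_inf; last by move=> r [].
by exists (`|x : R| + 1); split; rewrite ?ltr_wpDl // lerDl.
Qed.

Lemma real_complete (x : nat -> R^o) :
  (forall e : R, 0 < e -> exists N, forall m n, (N <= m)%N -> (N <= n)%N ->
     ounorm (x m - x n) < e) ->
  exists l : R^o, forall e : R, 0 < e -> exists N, forall n, (N <= n)%N ->
     ounorm (x n - l) < e.
Proof.
move=> cx; pose A := [set y : R | exists N, forall n, (N <= n)%N -> y <= x n].
have ubA e N : (forall m n, (N <= m)%N -> (N <= n)%N -> ounorm (x m - x n) < e) ->
    ubound A (x N + e) /\ A (x N - e).
  move=> xN; split.
    move=> y [M /(_ (maxn M N) (leq_maxl _ _)) yx].
    have := xN (maxn M N) N (leq_maxr _ _) (leqnn _).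
    rewrite real_ounormE ltr_norml => /andP[_ h]; apply: (le_trans yx).
    by rewrite addrC -lerBlDr ltW.
  exists N => n Nn; have := xN n N Nn (leqnn _).
  rewrite real_ounormE ltr_norml => /andP[h _].
  by move: h; rewrite ltrBrDr addrC => /ltW.
exists (sup A) => e e0; have [N xN] := cx _ (divr_gt0 e0 (ltr0n R 3)).
exists N => n Nn; have [ub Aa] := ubA _ _ xN.
have h1 : sup A <= x N + e / 3 by apply: ge_sup => //; exists (x N - e / 3).
have h2 : x N - e / 3 <= sup A by apply: ub_le_sup => //; exists (x N + e / 3).
have := xN n N Nn (leqnn _); rewrite !real_ounormE !ltr_norml.
by move=> /andP[h3 h4]; apply/andP; split; lra.
Qed.

Lemma real_sigma_complete (x : nat -> R^o) :
  {homo x : m n / (m <= n)%N >-> m <= n} -> has_ubound (range x) ->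
  exists s, supremums (range x) s.
Proof.
move=> _ ubx; exists (sup (range x : set R)); split.
  by move=> y xy; exact: ub_le_sup.
by move=> y; apply: ge_sup; exists (x 0%N), 0%N.
Qed.

HB.instance Definition _ :=
  isSigmaBOUS.Build R R^o real_complete real_sigma_complete.

Context (A : sigmaBOUSType R).

Definition real_to_bous (r : R^o) : A := (r : R) *: ounit.

Lemma real_to_bousP : is_bous_hom real_to_bous.
Proof.
rewrite /real_to_bous; split=> [a r s|r r0||x s xi xb [xs sx]].
- by rewrite scalerDl scalerA.
- exact/ordlmod_scale_ge0/ounit_ge0.
- by rewrite scale1r.
have scale_le (r t : R) : r <= t -> r *: (ounit : A) <= t *: ounit.
  move=> rt; have tr : 0 <= t - r by rewrite subr_ge0.
  have := ordlmod_scale_ge0 _ (ounit : A) tr ounit_ge0.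
  by move=> /(ordlmod_leD (r *: ounit)); rewrite addr0 scalerBl addrC subrK.
split=> [_ [n _ <-]|b xb']; first by apply/scale_le/xs; exists n.
suff : (s : R) *: ounit - b <= 0.
  by move=> /(ordlmod_leD b); rewrite addr0 addrC subrK.
apply: ounit_archi => -[|k]; first by rewrite mulr0n ounit_ge0.
have [n xn] : exists n, (s : R) - k.+1%:R^-1 < x n.
  apply: contrapT => /forallNP h.
  have : s <= (s : R) - k.+1%:R^-1.
    by apply: sx => _ [n _ <-]; rewrite leNgt; apply/negP/h.
  by apply/negP; rewrite -ltNge ltrBlDr ltrDl invr_gt0 ltr0n.
have xnb : (x n : R) *: ounit <= b by apply: xb'; exists n.
have {}xnb : (s : R) *: ounit - b <= k.+1%:R^-1 *: ounit.
  have := ordlmod_leD (k.+1%:R^-1 *: ounit - b) _ _ xnb.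
  rewrite subrK => /(le_trans _); apply.
  rewrite addrAC -scalerDl [leRHS]addrC [leLHS]addrC; apply: ordlmod_leD.
  by apply: scale_le; rewrite -lerBlDl ltW.
set d := (s : R) *: ounit - b in xnb *.
have d0 : 0 <= k.+1%:R^-1 *: ounit - d.
  by have := ordlmod_leD (- d) _ _ xnb; rewrite addNr addrC.
have := ordlmod_scale_ge0 k.+1%:R _ (ler0n R _) d0.
move=> /(ordlmod_leD (d *+ k.+1)).
by rewrite addr0 scalerBr scalerA divff ?pnatr_eq0 // scale1r scaler_nat
  addrC subrK.
Qed.

End RealLine.

(* In the opposite category [1_A : A -> R] is the map [r |-> r u] from the real
   line, with order unit 1, to [A]. *)
Definition sigmaBOUSop (R : realType) : truth_category :=
  @TruthCategory (op (sigmaBOUS R)) (R^o : sigmaBOUSType R)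
    (fun A => BousHom (real_to_bousP A)).

Section IntervalModule.
Context (R : realType) (A : sigmaBOUSType R).

Lemma interval_scaleP (r : unit_interval R) (a : interval (ounit : A)) :
  0 <= (val r : R) *: val a <= ounit.
Proof.
case: r a => [r /= /andP[r0 r1]] [a /= /andP[a0 a1]].
rewrite ordlmod_scale_ge0 //=; apply: le_trans a1.
have r1' : 0 <= 1 - r by rewrite subr_ge0.
have := ordlmod_scale_ge0 _ _ r1' a0.
by move=> /(ordlmod_leD (r *: a)); rewrite addr0 -scalerDl addrC subrK scale1r.
Qed.

Definition unit_interval_module : effect_module_sig R :=
  @EffectModuleSig R (interval_effect (ounit_ge0 : 0 <= (ounit : A)))
    (fun r a => exist _ ((val r : R) *: val a) (interval_scaleP r a)).

End IntervalModule.

(* Main.v *)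
(* Write E for the effect algebra Pred(A), on which [0,1] acts through the
   scalars.  Its totalization is built in two steps.  The cone generated by E
   consists of the functions t |-> "t k, if it lies in E"; sums are computed
   pointwise in the monoid obtained from E by adding an absorbing undefined
   element.  The space FA is the group of differences of this cone, and E is
   its unit interval.
   The limit axiom gives every increasing sequence in E a supremum: if
   a_(n+1) = a_n + d_n, then the family (a_0, d_0, d_1, ...) is summable, and
   putting b^perp in front of it for an upper bound b of the a_n shows that its
   sum is the least upper bound.  Hence FA is monotone sigma-complete.  It is
   archimedean because (1 - 2^-n) u increases to u, which comes from [0,1] via
   the sigma-additivity of precomposition with 1_A; norm completeness follows by
   shifting a fast Cauchy sequence into an increasing one.
   A sigma-normal subunital map is determined by its restriction to the unit
   interval, and every sigma-normal additive homogeneous map between unit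
   intervals extends, so p |-> p o f induces the functor.  It preserves
   coproducts because predicates on a coproduct which are componentwise
   summable are summable: untying the components gives a map into I + I that
   witnesses compatibility. *)

Require Import Defs.
From HB Require Import structures.
From mathcomp Require Import all_boot all_order all_algebra finmap.
From mathcomp Require Import generic_quotient.
From mathcomp Require Import boolp classical_sets reals.
From mathcomp Require Import ring lra.

Set Implicit Arguments.
Unset Strict Implicit.
Unset Printing Implicit Defensive.

Import Order.TTheory GRing.Theory Num.Theory.

Local Open Scope classical_set_scope.
Local Open Scope ring_scope.

(** * Countable sums *)

Section PartialSums.
Context (M : Type) (S : sigmaPAM M).

Lemma psum_ext (J : countType) (x y : J -> M) : x =1 y -> psum S x = psum S y.
Proof. by move=> /funext ->. Qed.

(** The fibres of a bijection are singletons, so partition-associativity along [h] together with the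
    unary law compares the two sums. Used in both directions it also matches undefinedness. *)
Lemma psum_bij (J J' : countType) (h : J' -> J) (x : J -> M) :
  bijective h -> psum S (x \o h) = psum S x.
Proof.
move=> [g hK gK].
have blk k : psum S (fun j : {j : J' | h j == k} => (x \o h) (val j))
    = Some (x k).
  have hgk : h (g k) == k by rewrite gK.
  rewrite (@psum_unary _ S _ (exist _ (g k) hgk)) /= ?gK //.
  by case=> j jk; apply: val_inj; rewrite /= -(eqP jk) hK.
case e : (psum S x) => [s|].
  by apply: (psum_partition S h _ _).2; exists x.
case e' : (psum S (x \o h)) => [s|] //.
have [y [yE ys]] := (psum_partition S h _ _).1 e'.
suff yx : y = x by rewrite -yx ys in e.
by apply/funext => k; have := yE k; rewrite blk => -[].
Qed.

(** The range of [h] is one block of a two-block partition of [J], and blocks of a summable family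
    are summable. *)
Lemma psum_inj (J J' : countType) (h : J' -> J) (x : J -> M) :
  injective h -> isSome (psum S x) -> isSome (psum S (x \o h)).
Proof.
move=> hI; case e : (psum S x) => [s|] // _.
pose p j := `[< exists j', h j' = j >].
have [y [yE _]] := (psum_partition S p _ _).1 e.
have hp j' : p (h j') == true by rewrite eqb_id; apply/asboolP; exists j'.
pose h' j' : {j | p j == true} := exist _ (h j') (hp j').
suff bh : bijective h'.
  have := psum_bij (fun j : {j : J | p j == true} => x (val j)) bh.
  by rewrite yE /= => ->.
have gex (j : {j | p j == true}) : exists j', h j' = val j.
  by case: j => j /= pj; move: (pj); rewrite eqb_id => /asboolP.
exists (fun j => sval (cid (gex j))).
  by move=> j'; case: cid => /= z /hI.
by move=> j; apply: val_inj => /=; case: cid.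
Qed.

(** Partition [option J] into [None] and the rest. With [obind] the equation is Kleene equality:
    either side is defined when the other is. *)
Lemma psum_option (J : countType) (x : J -> M) (a : M) :
  psum S (fun o : option J => oapp x a o) = obind (padd S a) (psum S x).
Proof.
pose X o := oapp x a o.
have blkN : psum S (fun o : {o : option J | ~~ isSome o == true} => X (val o))
    = Some a.
  have N : ~~ isSome (None : option J) == true by [].
  rewrite (@psum_unary _ S _ (exist _ None N)) //.
  by move=> [[j|] //= ?]; apply: val_inj.
have blkS : psum S (fun o : {o : option J | ~~ isSome o == false} => X (val o))
    = psum S x.
  have N j : ~~ isSome (Some j : option J) == false by [].
  pose h j : {o : option J | ~~ isSome o == false} := exist _ (Some j) (N j).
  have bh : bijective h.
    have gex (o : {o : option J | ~~ isSome o == false}) :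
      exists j, Some j = val o by case: o => [[j|] //= ?]; exists j.
    exists (fun o => sval (cid (gex o))).
      by move=> j; case: cid => z /= [].
    by move=> o; apply: val_inj => /=; case: cid.
  by rewrite -(psum_bij (fun o : {o | ~~ isSome o == false} => X (val o)) bh).
have part s : psum S X = Some s <->
    exists2 b, psum S x = Some b & padd S a b = Some s.
  split.
    move=> /(psum_partition S (fun o => ~~ isSome o) _ _).1 [y [yE ys]].
    have := yE true; rewrite blkN => -[ya].
    have := yE false; rewrite blkS => yb.
    exists (y false) => //; rewrite -ys /padd; apply: psum_ext.
    by case; rewrite ?ya.
  move=> [b xb ab]; apply: (psum_partition S (fun o => ~~ isSome o) _ _).2.
  by exists (fun i : bool => if i then a else b); split=> //;
    case; rewrite ?blkN ?blkS.
case e : (psum S X) => [s|]; first by have [b -> /= ->] := (part s).1 e.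
case e1 : (psum S x) => [b|] //=; case e2 : (padd S a b) => [s|] //.
by rewrite -e; apply/part; exists b.
Qed.

Lemma psum_nat (x : nat -> M) :
  psum S x = obind (padd S (x 0%N)) (psum S (fun n => x n.+1)).
Proof.
rewrite -psum_option.
pose h (o : option nat) := if o is Some n then n.+1 else 0%N.
have bh : bijective h.
  by exists (fun n => if n is m.+1 then Some m else None); case.
by rewrite -(psum_bij x bh); apply: psum_ext; case.
Qed.

Lemma psum_ord_recr n (x : nat -> M) :
  psum S (fun i : 'I_n.+1 => x i) =
  obind (padd S (x n)) (psum S (fun i : 'I_n => x i)).
Proof.
rewrite -psum_option.
pose h (o : option 'I_n) := oapp (lift ord_max) ord_max o.
have bh : bijective h.
  exists (unlift ord_max).
    by case=> [i|] /=; rewrite ?liftK ?unlift_none.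
  by move=> i; case: unliftP => [j ->|->].
rewrite -(psum_bij (fun i : 'I_n.+1 => x i) bh).
by apply: psum_ext; case=> [i|] //=; rewrite /bump leqNgt ltn_ord.
Qed.

(** Every finite set of indices lies in an initial segment, so the limit axiom needs only initial
    segments. *)
Lemma summable_nat (x : nat -> M) :
  (forall n, isSome (psum S (fun i : 'I_n => x i))) -> isSome (psum S x).
Proof.
move=> xn; apply: psum_limit => F.
pose N := (\max_(i : F) val i).+1.
have FN (i : F) : (val i < N)%N by rewrite ltnS (leq_bigmax i).
apply: (psum_inj (h := fun i : F => Ordinal (FN i)) _ (xn N)) => i j [ij].
exact: val_inj.
Qed.

Lemma padd_map (N : Type) (T : sigmaPAM N) (f : M -> N) :
  sigma_additive S T f ->
  forall x y s, padd S x y = Some s -> padd T (f x) (f y) = Some (f s).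
Proof.
by move=> fS x y s /fS <-; congr psum; apply/funext; case.
Qed.

Lemma pzero_map (N : Type) (T : sigmaPAM N) (f : M -> N) :
  sigma_additive S T f -> f (pzero S) = pzero T.
Proof.
move=> fS; rewrite /pzero; case: psum_void => z /= /fS.
have -> : f \o of_void M = of_void N by apply/funext; case.
by case: psum_void => w /= -> [].
Qed.

End PartialSums.

(** * Effect algebras as partial cancellative monoids *)

Record effectAlgebra := EffectAlgebra {
  ea_sig :> effect_sig;
  ea_axioms : is_effect_algebra ea_sig
}.

(* Undefinedness as an absorbing element turns the partial addition into a
   total one, so that Kleene equations become equations in a monoid. *)
Definition opt (E : effectAlgebra) := option E.
HB.instance Definition _ (E : effectAlgebra) := gen_eqMixin (opt E).
HB.instance Definition _ (E : effectAlgebra) := gen_choiceMixin (opt E).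

Section OptMonoid.
Context (E : effectAlgebra).
Implicit Types (a b c : E) (x y z : opt E).

Definition opt_add x y : opt E := obind (fun a => obind (eadd a) y) x.

Lemma opt_addA : associative opt_add.
Proof.
case=> [a|] [b|] [c|] //=; rewrite /opt_add /=; last by case: (eadd a b).
by rewrite -(eaddA (ea_axioms E)).
Qed.

Lemma opt_addC : commutative opt_add.
Proof. by case=> [a|] [b|] //=; apply: eaddC (ea_axioms E) _ _. Qed.

Lemma opt_add0 : left_id (Some ezero) opt_add.
Proof. by case=> [a|] //=; apply: eadd0 (ea_axioms E) _. Qed.

HB.instance Definition _ :=
  GRing.isNmodule.Build (opt E) opt_addA opt_addC opt_add0.

Definition defd (a : E) : opt E := Some a.

Lemma defdD a b : defd a + defd b = eadd a b. Proof. by []. Qed.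

Lemma opt_add_def x y c : x + y = defd c ->
  (exists a, x = defd a) /\ (exists b, y = defd b).
Proof.
case: x => [a|] //; case: y => [b|] // _.
by split; [exists a|exists b].
Qed.

Lemma defd0 : defd ezero = 0. Proof. by []. Qed.

Lemma opt_compl a : exists b, defd a + defd b = defd eone.
Proof. by have [b [ab _]] := eperp (ea_axioms E) a; exists b. Qed.

Lemma opt_compl_uniq a b c :
  defd a + defd b = defd eone -> defd a + defd c = defd eone -> b = c.
Proof.
move=> ab ac; have [d [_ du]] := eperp (ea_axioms E) a.
by rewrite -(du b ab) (du c ac).
Qed.

(** If c' is the complement of c, then b and the value of x are both complements of w = a + c',
    hence equal. *)
Lemma opt_cancel a b c x : defd a + defd b = defd c -> defd a + x = defd c ->
  x = defd b.
Proof.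
move=> ab ax; have [_ [d xd]] := opt_add_def ax; rewrite {}xd in ax *.
have [c' cc] := opt_compl c.
have := cc; rewrite -{1}ab -addrA addrCA addrC.
move=> /[dup] /opt_add_def [[w we] _]; rewrite we => w1.
have w2 : defd w + defd d = defd eone by rewrite -we addrAC ax.
by rewrite (opt_compl_uniq w2 w1).
Qed.

(** From a + (b + 1) = 0 + 1 the sum b + 1 is defined, so b = 0 by [eperp1]. *)
Lemma opt_zerosum a b : defd a + defd b = 0 -> a = ezero.
Proof.
move=> ab; have b1 : defd b + defd eone != None.
  apply/eqP => e; have := congr1 (fun x => x + defd eone) ab.
  by rewrite -addrA e add0r.
have b0 : b = ezero.
  apply: (eperp1 (ea_axioms E)).
  by move: b1; rewrite defdD; case: (eadd b eone) => [?|/eqP].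
move: ab; rewrite b0 (_ : defd ezero = 0) // addr0.
by case.
Qed.

Lemma eleP a b : ele a b <-> exists x, defd a + x = defd b.
Proof.
split=> [[c ac]|[x /[dup]/opt_add_def [_ [c ->]] ac]].
  by exists (defd c).
by exists c.
Qed.

Lemma ele_antisym a b : ele a b -> ele b a -> a = b.
Proof.
move=> [c ac] [d bd]; have : defd a + (defd c + defd d) = defd a.
  by rewrite addrA defdD ac.
move=> /(opt_cancel (b := ezero) (addr0 _)) /opt_zerosum c0.
by move: ac; rewrite c0 -[eadd _ _]/(defd a + 0) addr0 => -[].
Qed.

Lemma ele_one a : ele a eone.
Proof. by have [b ab] := opt_compl a; exists b. Qed.

End OptMonoid.

(** * Suprema of increasing sequences in effect algebras *)

Definition is_lub (E : effect_sig) (a : nat -> E) (s : E) :=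
  (forall n, ele (a n) s) /\ forall b, (forall n, ele (a n) b) -> ele s b.

Section EffectSums.
Context (M : Type) (S : sigmaPAM M) (u : M).
Let E := @EffectSig M (padd S) (pzero S) u.
Hypothesis EP : is_effect_algebra E.

(** The first n+1 terms of a_0, d_0, d_1, ... sum to a_n, so the limit axiom applies; splitting off
    the head then gives both sums. *)
Lemma series_psum (a d : nat -> M) :
  (forall n, padd S (a n) (d n) = Some (a n.+1)) ->
  exists D s, psum S d = Some D /\ padd S (a 0%N) D = Some s.
Proof.
move=> ad; pose x n := if n is m.+1 then d m else a 0%N.
have xn n : psum S (fun i : 'I_n.+1 => x i) = Some (a n).
  elim: n => [|n IHn].
    by rewrite (@psum_unary _ S _ ord0) // => j; rewrite ord1.
  by rewrite psum_ord_recr IHn /= -ad [LHS](@eaddC _ EP).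
have : isSome (psum S x).
  (* The empty segment is summable as a part of the one-term segment. *)
  apply: summable_nat => -[|n]; last by rewrite xn.
  have := psum_ord_recr S 0 x; rewrite xn.
  by case: (psum S (fun i : 'I_0 => x i)).
rewrite psum_nat /=; case: (psum S d) => [D|] //=.
by case e : (padd S (a 0%N) D) => [s|] // _; exists D, s.
Qed.

(** Moving d_0 from the series into the start, a_0 + (d_0 + D') = a_1 + D', keeps the total [s], so
    induction reaches every a_n. *)
Lemma series_ub (a d : nat -> M) D s :
  (forall n, padd S (a n) (d n) = Some (a n.+1)) ->
  psum S d = Some D -> padd S (a 0%N) D = Some s ->
  forall n, @ele E (a n) s.
Proof.
move=> + + + n; elim: n a d D s => [|n IHn] a d D s ad dD aD; first by exists D.
have [D' [s' [dD' aD']]] := series_psum (fun k => ad k.+1).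
apply: (IHn (fun k => a k.+1) (fun k => d k.+1) D' s (fun k => ad k.+1)) => //=.
move: dD; rewrite psum_nat dD' /= => dD.
have := @eaddA _ EP (a 0%N) (d 0%N) D'.
by rewrite /= ad /= dD /= aD.
Qed.

(** With c the complement of a bound b, the sequence c + a_n has the same increments, so its series
    is summable too and c + s is defined. *)
Lemma series_lub (a d : nat -> M) D s :
  (forall n, padd S (a n) (d n) = Some (a n.+1)) ->
  psum S d = Some D -> padd S (a 0%N) D = Some s -> @is_lub E a s.
Proof.
move=> ad dD aD; split; first exact: series_ub ad dD aD.
move=> b ab; have [c [/= bc _]] := @eperp _ EP b.
have cb : padd S c b = Some u by rewrite -bc; apply: (@eaddC _ EP).
have ca n : exists t, padd S c (a n) = Some t.
  have [e /= ae] := ab n.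
  have := @eaddA _ EP (c : E) (a n) e; rewrite /= ae /= cb.
  by case: (padd S c (a n)) => [t|] // _; exists t.
pose a' n := sval (cid (ca n)).
have aE n : padd S c (a n) = Some (a' n) by rewrite /a'; case: cid.
have a'd n : padd S (a' n) (d n) = Some (a' n.+1).
  have := @eaddA _ EP (c : E) (a n) (d n).
  by rewrite /= ad aE /= aE.
have [D' [s' [dD' aD']]] := series_psum a'd.
move: dD'; rewrite dD => -[DD']; rewrite -{}DD' in aD'.
have := @eaddA _ EP (c : E) (a 0%N) D; rewrite /= aE /= aD' aD /= => cs.
(* Completing c + s to the unit by c' makes s + c' a second complement of c; uniqueness gives s + c'
   = b. *)
have [c' [/= sc' _]] := @eperp _ EP s'.
have := @eaddA _ EP (c : E) s c'; rewrite /= -cs /= sc'.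
case e : (padd S s c') => [t|] //= ct.
have [b' [_ bu]] := @eperp _ EP c.
have <- : t = b.
  by rewrite -(bu t (esym ct)) (bu b cb).
by exists c'.
Qed.

Lemma increasing_lub (a : nat -> E) :
  (forall n, ele (a n) (a n.+1)) -> exists s, is_lub a s.
Proof.
move=> /choice [d ad]; have [D [s [dD aD]]] := series_psum ad.
by exists s; apply: series_lub ad dD aD.
Qed.

End EffectSums.

(** The supremum is a_0 plus the sum of the increments ([series_lub]), and [f] preserves such
    sums. *)
Lemma additive_lub (M N : Type) (S : sigmaPAM M) (T : sigmaPAM N)
    (u : M) (v : N) (f : M -> N) (a : nat -> M) (s : M) :
  let E := @EffectSig M (padd S) (pzero S) u in
  let E' := @EffectSig N (padd T) (pzero T) v in
  is_effect_algebra E -> is_effect_algebra E' -> sigma_additive S T f ->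
  (forall n, @ele E (a n) (a n.+1)) -> @is_lub E a s ->
  @is_lub E' (f \o a) (f s).
Proof.
move=> E E' EP EP' fS /choice [d ad] [as1 as2].
have [D [s' [dD aD]]] := series_psum EP ad.
have [ub lb] := series_lub EP ad dD aD.
have <- : s' = s.
  by apply: (@ele_antisym (EffectAlgebra EP)); [exact: lb|exact: as2].
apply: (series_lub EP' (d := f \o d) (D := f D)); rewrite ?(fS _ _ _ dD) //=.
  by move=> n; apply: padd_map fS _ _ _ (ad n).
exact: padd_map fS _ _ _ aD.
Qed.

(** * The cone generated by a convex effect algebra *)

Lemma half_bound (R : realType) : 0 <= (2^-1 : R) <= 1.
Proof. by apply/andP; split; lra. Qed.

Lemma itv_ocW (R : realType) (s : R) : 0 < s <= 1 -> 0 <= s <= 1.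
Proof. by case/andP => s0 ->; rewrite ltW. Qed.

Lemma pow_half_bound (R : realType) n : 0 <= (2 ^- n : R) <= 1.
Proof.
by rewrite invr_ge0 exprn_ge0 //= invf_le1 ?exprn_gt0 // exprn_ege1 ?ler1n.
Qed.

Lemma pow_half_le (R : realType) (x : R) : 0 < x -> exists n, 2 ^- n <= x.
Proof.
move=> x0; exists (Num.bound x^-1).
have := archi_boundP (ltW (_ : 0 < x^-1)); rewrite invr_gt0 => /(_ x0) xb.
rewrite -[leRHS]invrK lef_pV2 ?posrE ?invr_gt0 ?exprn_gt0 //.
by apply/ltW/(lt_trans xb); rewrite -natrX ltr_nat ltn_expl.
Qed.

(** Collects what the construction uses of Pred(A). The action is total on [R], with laws only for
    scalars in [0,1]; [club1] is the source of the archimedean property. *)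
Record convexEffect (R : realType) := ConvexEffect {
  cea :> effectAlgebra;
  cact : R -> cea -> cea;
  cact1 : forall a, cact 1 a = a;
  cactA : forall r s a, 0 <= r <= 1 -> 0 <= s <= 1 ->
    cact r (cact s a) = cact (r * s) a;
  cactDl : forall r s a, 0 <= r -> 0 <= s -> r + s <= 1 ->
    eadd (cact r a) (cact s a) = Some (cact (r + s) a);
  cactDr : forall r a b c, 0 <= r <= 1 -> eadd a b = Some c ->
    eadd (cact r a) (cact r b) = Some (cact r c);
  csup : forall a : nat -> cea, (forall n, ele (a n) (a n.+1)) ->
    exists s, is_lub a s;
  club1 : is_lub (fun n => cact (1 - 2 ^- n) eone) eone
}.

Section Cone.
Context (R : realType) (E : convexEffect R).
Implicit Types (a b c : E) (r s t : R).

Lemma cact0 a : cact 0 a = ezero.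
Proof.
have := @cactDl _ E 0 0 a (lexx _) (lexx _); rewrite addr0 ler01 => /(_ isT).
rewrite -defdD => /esym e.
have : defd (cact 0 a) + 0 = defd (cact 0 a) by rewrite addr0.
by rewrite -defd0 => /(opt_cancel (esym e))[].
Qed.

Lemma cact_zero r : 0 <= r <= 1 -> cact r ezero = ezero :> E.
Proof.
move=> r01; have := @cactDr _ E r ezero ezero ezero r01.
rewrite -defdD defd0 addr0 => /(_ erefl) e.
have : defd (cact r ezero) + 0 = defd (cact r ezero : E) by rewrite addr0.
by rewrite -defd0 => /(opt_cancel e)[].
Qed.

Lemma cact_half a : defd (cact 2^-1 a) + defd (cact 2^-1 a) = defd a.
Proof.
have h : 2^-1 + 2^-1 = 1 :> R by lra.
by rewrite defdD cactDl ?h ?cact1 //; lra.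
Qed.

Lemma cact_half_eq a b : defd a + defd a = defd b -> a = cact 2^-1 b.
Proof.
move=> ab; have := @cactDr _ E 2^-1 a a b (half_bound R) ab.
by rewrite -defdD cact_half => -[].
Qed.

(** Doubling undoes 1/2, hence every 2^-n acts injectively; for 2^-n <= r, acting further by 2^-n /
    r reduces r to 2^-n. *)
Lemma cact_inj r : 0 < r <= 1 -> injective (cact r : E -> E).
Proof.
have half_inj : injective (cact 2^-1 : E -> E).
  by move=> a b ab; have := cact_half a; rewrite ab cact_half => -[].
have pow_inj n : injective (cact (2^-n) : E -> E).
  elim: n => [|n IHn] a b; first by rewrite expr0 invr1 !cact1.
  rewrite exprS invfM => ab; apply/IHn/half_inj.
  by rewrite !cactA ?half_bound ?pow_half_bound.
move=> /andP[r0 r1]; have [n nr] := pow_half_le r0.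
move=> a b /(congr1 (cact (2 ^-n / r))).
have h : 0 <= 2 ^-n / r <= 1.
  have /andP[p0 _] := pow_half_bound R n.
  by rewrite divr_ge0 ?(ltW r0) //= ler_pdivrMr // mul1r.
have h' : 0 <= r <= 1 by rewrite ltW.
by rewrite !cactA // divfK ?gt_eqF // => /pow_inj.
Qed.

(** Both halves lie below half the unit, and two halves of the unit can be added. *)
Lemma half_sum_def a b :
  exists c, defd (cact 2^-1 a) + defd (cact 2^-1 b) = defd c.
Proof.
have [a' aa] := opt_compl a; have [b' bb] := opt_compl b.
have ah : defd (cact 2^-1 a) + defd (cact 2^-1 a') = defd (cact 2^-1 eone).
  exact: cactDr (half_bound R) aa.
have bh : defd (cact 2^-1 b) + defd (cact 2^-1 b') = defd (cact 2^-1 eone).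
  exact: cactDr (half_bound R) bb.
have := cact_half eone; rewrite -{1}ah -bh addrACA.
by move=> /opt_add_def [].
Qed.

(* The element [k] of the cone is encoded by the map sending [t] to [|t| k] if
   the latter lies in [E] and to [None] otherwise.  Since the domain of this
   map is determined by [k], addition is pointwise. *)
Record cone := Cone {
  cval :> R -> opt E;
  cval_even : forall t, cval (- t) = cval t;
  cval_scale : forall s t a, 0 <= s <= 1 -> cval t = defd a ->
    cval (s * t) = defd (cact s a);
  cval_half : forall t, cval t = cval (t / 2) + cval (t / 2);
  cval_def : exists2 t, 0 < t & exists a, cval t = defd a
}.

Implicit Types k l m : cone.

Lemma cone_ext k l : k =1 l -> k = l.
Proof.
move=> /funext; case: k => f e s h d; case: l => f' e' s' h' d' /= ff.
by case: _ / ff in e' s' h' d' *; congr Cone; exact: Prop_irrelevance.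
Qed.

Lemma cval_pow k t n : k t = k (t / 2 ^+ n) *+ 2 ^ n.
Proof.
elim: n => [|n IHn]; first by rewrite expr0 divr1.
by rewrite IHn cval_half -mulr2n -mulrnA exprSr invfM mulrA expnS.
Qed.

Lemma cval_abs k t : k `|t| = k t.
Proof. by have [//|_] := ger0P t; rewrite cval_even. Qed.

Lemma cval_le k t s a : `|s| <= t -> k t = defd a ->
  k s = defd (cact (`|s| / t) a).
Proof.
move=> st kt; have t0 : 0 <= t := le_trans (normr_ge0 _) st.
have [t00|tn] := eqVneq t 0.
  rewrite t00 in st kt *; have -> : s = 0 by apply/eqP; rewrite -normr_le0.
  have h : 0 <= (0 : R) <= 1 by rewrite lexx ler01.
  by rewrite normr0 mul0r -(cval_scale h kt) mulr0.
have tp : 0 < t by rewrite lt0r tn.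
rewrite -cval_abs -(@cval_scale k _ t) ?divfK //.
by rewrite divr_ge0 //= ler_pdivrMr // mul1r.
Qed.

Lemma cval0 k : k 0 = 0.
Proof.
have [t t0 [a ka]] := cval_def k.
by rewrite (@cval_le k t 0 a) ?normr0 ?mul0r ?cact0 // ltW.
Qed.

(** Repeated halving moves any s into [-|t|, |t|], where both values are the same multiple of a;
    doubling back by [cval_pow] gives equality even where the values are undefined. *)
Lemma germ k l t a : t != 0 -> k t = defd a -> l t = defd a -> k = l.
Proof.
move=> t0 kt lt; apply: cone_ext => s.
have [->|s0] := eqVneq s 0; first by rewrite !cval0.
have t0' : 0 < `|t| by rewrite normr_gt0.
have s0' : 0 < `|s| by rewrite normr_gt0.
have [n nt] := pow_half_le (divr_gt0 t0' s0').
have h : `|s / 2 ^+ n| <= `|t|.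
  rewrite normrM normfV (ger0_norm (exprn_ge0 _ _)) // mulrC.
  by rewrite -ler_pdivlMr.
rewrite (cval_pow k s n) (cval_pow l s n).
by rewrite (cval_le (a := a) h) ?cval_abs // (cval_le (a := a) h) ?cval_abs.
Qed.

Lemma cval_def2 k l : exists2 t, 0 < t &
  exists a b, k t = defd a /\ l t = defd b.
Proof.
have [t t0 [a ka]] := cval_def k; have [s s0 [b lb]] := cval_def l.
have [ts|st] := leP t s.
  exists t => //; exists a, (cact (`|t| / s) b); split=> //.
  by apply: cval_le; rewrite ?gtr0_norm.
exists s => //; exists (cact (`|s| / t) a), b; split=> //.
by apply: cval_le; rewrite ?gtr0_norm // ltW.
Qed.

Lemma czero_scale s t a : 0 <= s <= 1 -> (0 : opt E) = defd a ->
  (0 : opt E) = defd (cact s a).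
Proof. by move=> s01 [<-]; rewrite cact_zero. Qed.

Definition czero : cone.
Proof.
apply: (@Cone (fun=> 0)) => //; first by move=> s _ a; apply: czero_scale.
- by move=> t; rewrite addr0.
- by exists 1 => //; exists ezero.
Defined.

Definition cadd k l : cone.
Proof.
apply: (@Cone (fun t => k t + l t)).
- by move=> t; rewrite !cval_even.
- move=> s t c s01 /[dup] /opt_add_def [[a ka] [b lb]].
  rewrite ka lb (cval_scale s01 ka) (cval_scale s01 lb).
  exact: cactDr.
- by move=> t; rewrite addrACA -!cval_half.
(* At t both values are defined but their sum may not be; at t/2 it is. *)
- have [t t0 [a [b [ka lb]]]] := cval_def2 k l; exists (2^-1 * t).
    by rewrite mulr_gt0 // invr_gt0.
  by rewrite (cval_scale (half_bound R) ka) (cval_scale (half_bound R) lb);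
    apply: half_sum_def.
Defined.

Definition cscale r k : cone.
Proof.
apply: (@Cone (fun t => k (r * t))).
- by move=> t; rewrite mulrN cval_even.
- by move=> s t a s01 ka; rewrite mulrCA (cval_scale s01 ka).
- by move=> t; rewrite mulrA -cval_half.
- have [->|r0] := eqVneq r 0.
    by exists 1 => //; exists ezero; rewrite mul0r cval0.
  have [t t0 [a ka]] := cval_def k; exists (t / `|r|).
    by rewrite divr_gt0 // normr_gt0.
  exists a; rewrite -cval_abs normrM normf_div (gtr0_norm t0) normr_id mulrC.
  by rewrite divfK // normr_eq0.
Defined.

HB.instance Definition _ := gen_eqMixin cone.
HB.instance Definition _ := gen_choiceMixin cone.

Lemma caddA : associative cadd.
Proof. by move=> k l m; apply: cone_ext => t /=; rewrite addrA. Qed.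
Lemma caddC : commutative cadd.
Proof. by move=> k l; apply: cone_ext => t /=; rewrite addrC. Qed.
Lemma cadd0 : left_id czero cadd.
Proof. by move=> k; apply: cone_ext => t /=; rewrite add0r. Qed.

HB.instance Definition _ := GRing.isNmodule.Build cone caddA caddC cadd0.

Lemma cvalD k l t : (k + l) t = k t + l t. Proof. by []. Qed.
Lemma cval_zero t : (0 : cone) t = 0. Proof. by []. Qed.

Lemma cscaleDr r k l : cscale r (k + l) = cscale r k + cscale r l.
Proof. exact: cone_ext. Qed.
Lemma cscaler0 r : cscale r 0 = 0.
Proof. exact: cone_ext. Qed.
Lemma cscale1 k : cscale 1 k = k.
Proof. by apply: cone_ext => t /=; rewrite mul1r. Qed.
Lemma cscaleA r s k : cscale r (cscale s k) = cscale (r * s) k.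
Proof. by apply: cone_ext => t /=; rewrite mulrCA mulrA. Qed.

(** By [germ] one point suffices: at t/(r+s) the left side is k t = a, and the right side splits a
    in the proportions r/(r+s) and s/(r+s). *)
Lemma cscaleDl r s k : 0 <= r -> 0 <= s ->
  cscale (r + s) k = cscale r k + cscale s k.
Proof.
move=> r0 s0; have [rs|rs] := eqVneq (r + s) 0.
  have -> : r = 0 by lra.
  have -> : s = 0 by lra.
  by apply: cone_ext => t; rewrite cvalD /= addr0 mul0r cval0 addr0.
have rsp : 0 < r + s by rewrite lt0r rs addr_ge0.
have [t t0 [a ka]] := cval_def k.
have hr : 0 <= r / (r + s) <= 1.
  by rewrite divr_ge0 ?(ltW rsp) //= ler_pdivrMr // mul1r lerDl.
have hs : 0 <= s / (r + s) <= 1.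
  by rewrite divr_ge0 ?(ltW rsp) //= ler_pdivrMr // mul1r lerDr.
apply: (@germ _ _ (t / (r + s)) a).
- by rewrite gt_eqF // divr_gt0.
- by rewrite /= mulrC divfK.
rewrite cvalD /= mulrCA [s * _]mulrCA ![t * _]mulrC.
rewrite (cval_scale hr ka) (cval_scale hs ka) defdD.
have h : r / (r + s) + s / (r + s) = 1 by rewrite -mulrDl divff.
by case/andP: hr; case/andP: hs => *; rewrite cactDl ?h ?cact1.
Qed.

(** Cancel in E at one point where the sum is defined; [germ] extends the equality to all points. *)
Lemma cadd_cancel k l m : k + l = k + m -> l = m.
Proof.
move=> klm; have [t t0 [c [_ [kl _]]]] := cval_def2 (k + l) 0.
have km : (k + m) t = defd c by rewrite -klm.
move: kl km; rewrite !cvalD.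
move=> /[dup] /opt_add_def [[a ->] [b lb]]; rewrite lb => abc.
by move=> /(opt_cancel abc) mb; apply: (@germ _ _ t b) => //; rewrite gt_eqF.
Qed.

Lemma cadd_zerosum k l : k + l = 0 -> k = 0.
Proof.
move=> kl; apply: (@germ _ _ 1 ezero) => //; first exact: oner_neq0.
have := congr1 (fun m : cone => m 1) kl; rewrite cvalD cval_zero.
by move=> /[dup] /opt_add_def [[a ->] [b ->]] /opt_zerosum ->.
Qed.

(* [b = |t| a], scaled down by [s] so that both sides lie in [E]. *)
Definition cemb_graph a t b :=
  exists2 s, 0 < s <= 1 & `|s * t| <= 1 /\ cact s b = cact `|s * t| a.

(** Scaling b and b' by s s' gives the same multiple of a, and [cact_inj] removes the factor. *)
Lemma cemb_graph_fun a t b b' : cemb_graph a t b -> cemb_graph a t b' -> b = b'.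
Proof.
move=> [s s01 [st sb]] [s' s01' [st' sb']].
have h := itv_ocW s01; have h' := itv_ocW s01'.
have ss : 0 < s * s' <= 1.
  move: s01 s01' => /andP[s0 s1] /andP[s0' s1'].
  by rewrite mulr_gt0 //= mulr_ile1 // ltW.
apply: (cact_inj ss); rewrite -(cactA b') // mulrC -(cactA b) // sb sb'.
rewrite !cactA ?normr_ge0 //; congr cact.
by rewrite !normrM; case/andP: h => h _; case/andP: h' => h' _;
  rewrite (ger0_norm h) (ger0_norm h') mulrCA.
Qed.

Lemma cemb_graph_half a t b : cemb_graph a t b <->
  exists2 c, cemb_graph a (t / 2) c & defd c + defd c = defd b.
Proof.
split=> [[s s01 [st sb]]|[c [s /andP[s0 s1] [st sc]] cb]].
  exists (cact 2^-1 b); last exact: cact_half.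
  have h := itv_ocW s01.
  exists s => //; have -> : `|s * (t / 2)| = 2^-1 * `|s * t|.
    by rewrite mulrA normrM mulrC ger0_norm // invr_ge0.
  split; first by have := normr_ge0 (s * t); lra.
  rewrite cactA ?half_bound // mulrC -cactA ?half_bound // sb.
  by rewrite cactA ?half_bound // normr_ge0.
have h : 0 <= s <= 1 by rewrite ltW.
(* Since c is half of b, (s/2) b = s c, so the witness is halved. *)
exists (s / 2); first by apply/andP; split; lra.
have -> : s / 2 * t = s * (t / 2) by rewrite mulrAC mulrA.
split=> //; rewrite -sc -cactA ?half_bound //.
by rewrite (cact_half_eq cb).
Qed.

Definition cemb_fun a t : opt E :=
  if pselect (exists b, cemb_graph a t b) is left e then defd (sval (cid e))
  else None.

Lemma cemb_funP a t b : cemb_fun a t = defd b <-> cemb_graph a t b.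
Proof.
rewrite /cemb_fun; case: pselect => [e|ne]; last first.
  by split=> // ab; case: ne; exists b.
case: cid => /= b' ab'; split=> [[<-] //|ab]; congr defd.
exact: cemb_graph_fun ab' ab.
Qed.

Definition cemb a : cone.
Proof.
apply: (@Cone (cemb_fun a)).
- have imp t b : cemb_graph a t b -> cemb_graph a (- t) b.
    by move=> [s s01]; exists s => //; rewrite mulrN normrN.
  move=> t; case e : (cemb_fun a t) => [b|].
    by apply/cemb_funP/imp/cemb_funP.
  case e' : (cemb_fun a (- t)) => [b|] //.
  by move/cemb_funP/imp/cemb_funP : e'; rewrite opprK e.
- move=> s t b s01 /cemb_funP [s' s01' [st sb]]; apply/cemb_funP.
  have h := itv_ocW s01'.
  exists s' => //; have -> : `|s' * (s * t)| = s * `|s' * t|.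
    by case/andP: s01 => s0 s1; rewrite mulrCA normrM ger0_norm.
  split; first by case/andP: s01 => s0 s1; rewrite mulr_ile1.
  by rewrite cactA // mulrC -cactA // sb cactA // normr_ge0.
- move=> t; case e : (cemb_fun a t) => [b|].
    by move/cemb_funP/cemb_graph_half : e => [c /cemb_funP -> ->].
  case e' : (cemb_fun a (t / 2)) => [c|] //; move/cemb_funP : e' => e'.
  case e2 : (defd c + defd c) => [b|] //; move: e.
  by have /cemb_funP -> : cemb_graph a t b by apply/cemb_graph_half; exists c.
- exists 1 => //; exists a; apply/cemb_funP; exists 1; rewrite ?ltr01 ?lexx //.
  by rewrite mulr1 normr1 lexx.
Defined.

Lemma cembE a : cemb a 1 = defd a.
Proof.
apply/cemb_funP; exists 1; rewrite ?ltr01 ?lexx //.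
by rewrite mulr1 normr1 lexx.
Qed.

Lemma cemb_uniq k a : k 1 = defd a -> k = cemb a.
Proof. by move=> ka; apply: (@germ _ _ 1 a); rewrite ?oner_neq0 ?cembE. Qed.

Lemma cemb_inj : injective cemb.
Proof. by move=> a b ab; have := cembE a; rewrite ab cembE => -[]. Qed.

Lemma cembD a b c : eadd a b = Some c -> cemb a + cemb b = cemb c.
Proof. by move=> abc; apply: cemb_uniq; rewrite cvalD !cembE. Qed.

Lemma cemb0 : cemb ezero = 0.
Proof. by apply/esym/cemb_uniq. Qed.

Lemma cemb_act r a : 0 <= r <= 1 -> cemb (cact r a) = cscale r (cemb a).
Proof.
move=> r01; apply/esym/cemb_uniq => /=.
exact: cval_scale r01 (cembE a).
Qed.

(** A sum defined at 1 has both terms defined at 1, so the unit interval of the cone is E. *)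
Lemma cemb_le_one k l : k + l = cemb eone ->
  exists2 a, k = cemb a & exists2 b, l = cemb b & eadd a b = Some eone.
Proof.
move=> /(congr1 (fun m : cone => m 1)); rewrite cvalD cembE.
move=> /[dup] /opt_add_def [[a ka] [b lb]]; rewrite ka lb => ab.
by exists a; [exact: cemb_uniq|exists b => //; exact: cemb_uniq].
Qed.

Lemma cone_bound k : exists (n : nat) l, k + l = cemb eone *+ n.
Proof.
have cscale_nat n m : cscale n%:R m = m *+ n.
  elim: n => [|n IHn]; first by apply: cone_ext => t /=; rewrite mul0r cval0.
  by rewrite -natr1 cscaleDl ?ler0n // IHn cscale1 mulrSr.
have [t t0 [a ka]] := cval_def k; have [b ab] := opt_compl a.
have kE : k = cscale t^-1 (cemb a).
  apply: (@germ _ _ t a) => //; first by rewrite gt_eqF.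
  by rewrite [LHS]/= mulVf ?gt_eqF //; apply: cembE.
have tb := archi_boundP (ltW (_ : 0 < t^-1)); rewrite invr_gt0 in tb.
move/(_ t0)/ltW : tb; set n := Num.bound _ => tn.
(* With k = a/t and a + b the unit, adding b/t gives u/t; the second term fills this up to n u,
   where n >= 1/t. *)
exists n, (cscale t^-1 (cemb b) + cscale (n%:R - t^-1) (cemb eone)).
rewrite addrA {1}kE -cscaleDr (cembD ab).
rewrite -cscaleDl ?invr_ge0 ?(ltW t0) ?subr_ge0 //.
by rewrite addrC subrK cscale_nat.
Qed.

End Cone.

(** * Differences of cone elements *)

Section Span.
Local Open Scope quotient_scope.
Context (R : realType) (E : convexEffect R).
Implicit Types (a b c : E) (r s t : R) (k l m : cone E).

Definition diff_eq (x y : cone E * cone E) := x.1 + y.2 == y.1 + x.2.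

Lemma diff_eq_refl : reflexive diff_eq.
Proof. by move=> x; apply: eqxx. Qed.

Lemma diff_eq_sym : symmetric diff_eq.
Proof. by move=> x y; apply: eq_sym. Qed.

(** Transitivity is where cancellation in the cone enters. *)
Lemma diff_eq_trans : transitive diff_eq.
Proof.
move=> y x z /eqP xy /eqP yz; apply/eqP/(@cadd_cancel _ _ y.2).
by rewrite addrA [y.2 + x.1]addrC xy addrAC yz addrCA addrA.
Qed.

Canonical diff_eq_equiv_rel :=
  EquivRel diff_eq diff_eq_refl diff_eq_sym diff_eq_trans.

Definition espan := {eq_quot diff_eq}.
HB.instance Definition _ := Choice.on espan.

Definition diff k l : espan := \pi_({eq_quot diff_eq}) (k, l).

Lemma diffP k l k' l' : diff k l = diff k' l' <-> k + l' = k' + l.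
Proof.
by rewrite /diff; split=> [/eqmodP/eqP|e] //; apply/eqmodP/eqP.
Qed.

Lemma diffE (x : espan) : exists k l, x = diff k l.
Proof.
by exists (repr x).1, (repr x).2; rewrite /diff -surjective_pairing reprK.
Qed.

Definition sadd (x y : espan) : espan :=
  diff ((repr x).1 + (repr y).1) ((repr x).2 + (repr y).2).
Definition sopp (x : espan) : espan := diff (repr x).2 (repr x).1.
Definition sscale (r : R) (x : espan) : espan :=
  diff (cscale r (repr x).1) (cscale r (repr x).2).

Lemma repr_diff k l : (repr (diff k l)).1 + l = k + (repr (diff k l)).2.
Proof. by apply/diffP; rewrite /diff -surjective_pairing reprK. Qed.

Lemma saddE k l k' l' : sadd (diff k l) (diff k' l') = diff (k + k') (l + l').
Proof. by apply/diffP; rewrite addrACA !repr_diff addrACA. Qed.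

Lemma soppE k l : sopp (diff k l) = diff l k.
Proof. by apply/diffP; rewrite addrC -repr_diff addrC. Qed.

Lemma sscaleE r k l : sscale r (diff k l) = diff (cscale r k) (cscale r l).
Proof. by apply/diffP; rewrite -!cscaleDr repr_diff. Qed.

Lemma saddA : associative sadd.
Proof.
move=> x y z; have [[k [l ->]] [[k' [l' ->]] [m [n ->]]]] :=
  (diffE x, (diffE y, diffE z)).
by rewrite !saddE !addrA.
Qed.

Lemma saddC : commutative sadd.
Proof.
move=> x y; have [[k [l ->]] [k' [l' ->]]] := (diffE x, diffE y).
by rewrite !saddE [k + _]addrC [l + _]addrC.
Qed.

Lemma sadd0 : left_id (diff 0 0) sadd.
Proof. by move=> x; have [k [l ->]] := diffE x; rewrite saddE !add0r. Qed.

Lemma saddN : left_inverse (diff 0 0) sopp sadd.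
Proof.
move=> x; have [k [l ->]] := diffE x; rewrite soppE saddE.
by apply/diffP; rewrite addr0 add0r addrC.
Qed.

HB.instance Definition _ := GRing.isZmodule.Build espan saddA saddC sadd0 saddN.

Definition cinc k : espan := diff k 0.

Lemma cincD k l : cinc (k + l) = cinc k + cinc l.
Proof. by rewrite [RHS]saddE addr0. Qed.

Lemma cinc0 : cinc 0 = 0. Proof. by []. Qed.

Lemma cinc_inj : injective cinc.
Proof. by move=> k l /diffP; rewrite !addr0. Qed.

Lemma diff_cinc k l : diff k l = cinc k - cinc l.
Proof.
have -> : - cinc l = diff 0 l by apply: soppE.
by rewrite [RHS]saddE addr0 add0r.
Qed.

Lemma spanE (x : espan) : exists k l, x = cinc k - cinc l.
Proof. by have [k [l ->]] := diffE x; exists k, l; apply: diff_cinc. Qed.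

(* [sscale] only depends on the absolute value of the scalar. *)
Definition sact r (x : espan) : espan :=
  sscale (Num.max r 0) x - sscale (Num.max (- r) 0) x.

Lemma sscaleD r : {morph sscale r : x y / x + y}.
Proof.
move=> x y; have [[k [l ->]] [k' [l' ->]]] := (diffE x, diffE y).
by rewrite [_ + _]saddE !sscaleE !cscaleDr [RHS]saddE.
Qed.

Lemma sscaleN r : {morph sscale r : x / - x}.
Proof.
by move=> x; have [k [l ->]] := diffE x; rewrite [- _]soppE !sscaleE [RHS]soppE.
Qed.

Lemma sscaleB r : {morph sscale r : x y / x - y}.
Proof. by move=> x y; rewrite sscaleD sscaleN. Qed.

Lemma sscaleDl r s x : 0 <= r -> 0 <= s ->
  sscale (r + s) x = sscale r x + sscale s x.
Proof.
move=> r0 s0; have [k [l ->]] := diffE x.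
by rewrite !sscaleE !cscaleDl // [RHS]saddE.
Qed.

Lemma sscaleA r s x : sscale r (sscale s x) = sscale (r * s) x.
Proof. by have [k [l ->]] := diffE x; rewrite !sscaleE !cscaleA. Qed.

(** Any decomposition into nonnegative scalars may replace the positive and negative parts, so the
    module laws reduce to nonnegative scalars, for which [sscale] is additive. *)
Lemma sact_diff r s x : 0 <= r -> 0 <= s ->
  sact (r - s) x = sscale r x - sscale s x.
Proof.
move=> r0 s0; rewrite /sact.
have m0 t : 0 <= Num.max t 0 by rewrite le_max lexx orbT.
apply/eqP; rewrite subr_eq addrAC eq_sym subr_eq -!sscaleDl //; apply/eqP.
congr (sscale _ x); rewrite opprB.
by rewrite !maxEle; have [h|h] := lerP (s - r) 0;
  have [h'|h'] := lerP (r - s) 0; lra.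
Qed.

Lemma real_diff r : exists p q : R, [/\ 0 <= p, 0 <= q & r = p - q].
Proof.
have [r0|/ltW r0] := leP 0 r; first by exists r, 0; rewrite subr0.
by exists 0, (- r); rewrite oppr_ge0 opprK add0r.
Qed.

Lemma sactA r s x : sact r (sact s x) = sact (r * s) x.
Proof.
have [[p [q [p0 q0 ->]]] [p' [q' [p0' q0' ->]]]] := (real_diff r, real_diff s).
have -> : (p - q) * (p' - q') = (p * p' + q * q') - (p * q' + q * p') by ring.
rewrite !sact_diff ?addr_ge0 ?mulr_ge0 // !sscaleB !sscaleA.
by rewrite !sscaleDl ?mulr_ge0 // opprB opprD addrACA.
Qed.

Lemma sact1 : left_id 1 sact.
Proof.
move=> x; rewrite -[1]subr0 sact_diff ?ler01 //.
have [k [l ->]] := diffE x; rewrite !sscaleE !cscale1.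
have h m : cscale 0 m = 0 :> cone E.
  by apply: cone_ext => t /=; rewrite mul0r cval0.
by rewrite !h -[diff 0 0]/(0 : espan) subr0.
Qed.

Lemma sactDr : right_distributive sact +%R.
Proof. by move=> r x y; rewrite /sact !sscaleD opprD addrACA. Qed.

Lemma sactDl x : {morph sact^~ x : r s / r + s}.
Proof.
move=> r s /=.
have [[p [q [p0 q0 ->]]] [p' [q' [p0' q0' ->]]]] := (real_diff r, real_diff s).
by rewrite addrACA -opprD !sact_diff ?addr_ge0 // !sscaleDl // opprD addrACA.
Qed.

HB.instance Definition _ :=
  GRing.Zmodule_isLmodule.Build R espan sactA sact1 sactDr sactDl.

Lemma cinc_scale r k : 0 <= r -> cinc (cscale r k) = r *: cinc k.
Proof.
move=> r0; have -> : r *: cinc k = sscale r (cinc k) - sscale 0 (cinc k).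
  by rewrite -[LHS]/(sact _ _) -{1}[r]subr0 sact_diff.
have h m : cscale 0 m = 0 :> cone E.
  by apply: cone_ext => t /=; rewrite mul0r cval0.
by rewrite !sscaleE !h cscaler0 -[diff 0 0]/(0 : espan) subr0.
Qed.

Definition sle (x y : espan) := `[< exists k, y = x + cinc k >].
Definition slt (x y : espan) := (y != x) && sle x y.

Lemma sle_refl : reflexive sle.
Proof. by move=> x; apply/asboolP; exists 0; rewrite cinc0 addr0. Qed.

Lemma sle_anti : antisymmetric sle.
Proof.
move=> x y /andP[/asboolP[k ->] /asboolP[l]].
rewrite -addrA -cincD -[LHS]addr0 => /addrI; rewrite -cinc0 => /cinc_inj /esym.
by move=> /cadd_zerosum ->; rewrite cinc0 addr0.
Qed.

Lemma sle_trans : transitive sle.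
Proof.
move=> y x z /asboolP[k ->] /asboolP[l ->]; apply/asboolP; exists (k + l).
by rewrite cincD addrA.
Qed.

HB.instance Definition _ := Order.isPOrder.Build ring_display espan
  (fun x y => erefl : slt x y = (y != x) && sle x y)
  sle_refl sle_anti sle_trans.

HB.instance Definition _ := Num.POrderedZmodule.on espan.

Lemma sleP (x y : espan) : x <= y <-> exists k, y = x + cinc k.
Proof. by split=> /asboolP. Qed.

Lemma span_leD (z x y : espan) : x <= y -> z + x <= z + y.
Proof. by move=> /sleP[k ->]; apply/sleP; exists k; rewrite addrA. Qed.

Lemma cinc_ge0 k : 0 <= cinc k.
Proof. by apply/sleP; exists k; rewrite add0r. Qed.

Lemma span_ge0P (x : espan) : 0 <= x <-> exists k, x = cinc k.
Proof.
split=> [/sleP[k ->]|[k ->]]; last exact: cinc_ge0.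
by exists k; rewrite add0r.
Qed.

Lemma span_scale_ge0 r (x : espan) : 0 <= r -> 0 <= x -> 0 <= r *: x.
Proof.
by move=> r0 /span_ge0P[k ->]; apply/span_ge0P; exists (cscale r k);
  rewrite cinc_scale.
Qed.

HB.instance Definition _ :=
  isOrderedLmodule.Build R espan span_leD span_scale_ge0.

End Span.

(** * Order-unit spaces *)

Section OrderedLmodules.
Context (R : numDomainType) (V : ordLmodType R).
Implicit Types (x y z : V) (r s : R).

Lemma ordB_ge0 x y : (0 <= y - x) = (x <= y).
Proof.
apply/idP/idP => [/(ordlmod_leD x)|/(ordlmod_leD (- x))].
  by rewrite addr0 addrC subrK.
by rewrite addNr addrC.
Qed.

Lemma ordD x y x' y' : x <= y -> x' <= y' -> x + x' <= y + y'.
Proof.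
move=> xy xy'; apply: (le_trans (ordlmod_leD x _ _ xy')).
by rewrite addrC [leRHS]addrC ordlmod_leD.
Qed.

Lemma ordD2l z x y : (z + x <= z + y) = (x <= y).
Proof. by rewrite -(ordB_ge0 (z + x)) opprD addrACA subrr add0r ordB_ge0. Qed.

Lemma ordD2r z x y : (x + z <= y + z) = (x <= y).
Proof. by rewrite ![_ + z]addrC ordD2l. Qed.

Lemma ordN2 x y : (- x <= - y) = (y <= x).
Proof. by rewrite -(ordB_ge0 (- x)) opprK addrC ordB_ge0. Qed.

Lemma ord_subl_addr x y z : (x - y <= z) = (x <= z + y).
Proof. by rewrite -(ordD2r y (x - y)) subrK. Qed.

Lemma ord_subr_addr x y z : (x <= y - z) = (x + z <= y).
Proof. by rewrite -(ordD2r z x) subrK. Qed.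

Lemma ord_scale r x y : 0 <= r -> x <= y -> r *: x <= r *: y.
Proof.
by move=> r0 xy; rewrite -ordB_ge0 -scalerBr ordlmod_scale_ge0 // ordB_ge0.
Qed.

Lemma ord_scalel r s x : 0 <= x -> r <= s -> r *: x <= s *: x.
Proof.
by move=> x0 rs; rewrite -ordB_ge0 -scalerBl ordlmod_scale_ge0 // subr_ge0.
Qed.

End OrderedLmodules.

Section OrderUnitSpaces.
Context (R : realType) (V : orderUnitSpaceType R).
Implicit Types (x y z : V) (r s : R).
Local Notation u := (ounit : V).

(** A bound of at least 1 can be divided by, which is how elements are rescaled into the unit
    interval. *)
Lemma ounit_bound x : exists2 r : R, 1 <= r & - (r *: u) <= x <= r *: u.
Proof.
have [n /andP[nx xn]] := ounitP x; exists (n.+1%:R); first by rewrite ler1n.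
have h : u *+ n <= n.+1%:R *: u.
  by rewrite scaler_nat mulrSr -{1}[u *+ n]addr0 ordlmod_leD // ounit_ge0.
by rewrite (le_trans _ nx) ?ordN2 // (le_trans xn).
Qed.

Lemma ounorm_ltW x r : ounorm x < r -> - (r *: u) <= x <= r *: u.
Proof.
have [r0 r01 xr0] := ounit_bound x.
rewrite /ounorm; set A := [set _ | _] => xr.
have Ar0 : A r0 by split=> //; apply: lt_le_trans r01.
have [s [s0 /andP[sx xs]] sr] := inf_lt (ex_intro _ r0 Ar0) xr.
have h : s *: u <= r *: u by apply: ord_scalel (ltW sr); apply: ounit_ge0.
by rewrite (le_trans _ sx) ?ordN2 // (le_trans xs).
Qed.

Lemma ounorm_le x r : 0 < r -> - (r *: u) <= x <= r *: u -> ounorm x <= r.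
Proof.
move=> r0 xr; apply: ge_inf; last by split.
by exists 0 => s [/ltW].
Qed.


Lemma sigma_complete_banach :
  (forall x : nat -> V, {homo x : m n / (m <= n)%N >-> m <= n} ->
     has_ubound (range x) -> exists s : V, supremums (range x) s) ->
  forall x : nat -> V,
  (forall e : R, 0 < e -> exists N, forall m n, (N <= m)%N -> (N <= n)%N ->
     ounorm (x m - x n) < e) ->
  exists l : V, forall e : R, 0 < e -> exists N, forall n, (N <= n)%N ->
     ounorm (x n - l) < e.
Proof.
move=> sigma x cx.
have p0 k : 0 < 2 ^- k :> R by rewrite invr_gt0 exprn_gt0.
have /choice[N NP] k := cx _ (p0 k).
(* Partial sums make the index map monotone while it still dominates [N]. *)
pose i k := (\sum_(j < k.+1) N j)%N.
have iS k : (i k <= i k.+1)%N by rewrite /i [leqRHS]big_ord_recr leq_addr.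
have i_le : {homo i : j k / (j <= k)%N >-> (j <= k)%N}.
  exact: homo_leq leqnn leq_trans iS.
have Ni k : (N k <= i k)%N by rewrite /i big_ord_recr leq_addl.
have close k m n : (i k <= m)%N -> (i k <= n)%N -> x m - x n <= 2 ^- k *: u.
  move=> km kn; have := NP k m n (leq_trans (Ni k) km) (leq_trans (Ni k) kn).
  by move=> /ounorm_ltW/andP[].
(* From k to k+1 the subtracted multiple of u shrinks by 2^-k, which compensates the largest
   possible drop of the subsequence, so y increases. *)
pose y k := x (i k) - (2 * 2 ^- k) *: u.
have y_le : {homo y : j k / (j <= k)%N >-> j <= k}.
  apply: homo_leq => // [a b c|k]; first exact: le_trans.
  rewrite /y exprS invfM mulrA divff ?pnatr_eq0 // mul1r ord_subl_addr addrAC.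
  rewrite -addrA -scalerBl (_ : 2 * 2 ^- k - 2 ^- k = 2 ^- k); last by ring.
  by rewrite addrC -ord_subl_addr close.
have y_ub k n : (i k <= n)%N -> forall j, y j <= x n + 2 ^- k *: u.
  move=> kn; suff h j : (k <= j)%N -> y j <= x n + 2 ^- k *: u.
    by move=> j; have [/ltnW/y_le/le_trans|/h//] := ltnP j k; apply; apply: h.
  move=> kj; rewrite /y ord_subl_addr -[leLHS]addr0; apply: ordD.
    by rewrite addrC -ord_subl_addr close // i_le.
  by rewrite ordlmod_scale_ge0 ?ounit_ge0 // mulr_ge0 // ltW.
have [s [sub slb]] : exists s : V, supremums (range y) s.
  apply: sigma => //; exists (x (i 0%N) + 2 ^- 0 *: u) => _ [j _ <-].
  exact: y_ub.
(* The error is at most 3 * 2^-k: one part from x n to x (i k), two from the shift. Dividing by 4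
   makes the bound strict. *)
exists s => e e0; have [k ke] := pow_half_le (divr_gt0 e0 (ltr0n R 4)).
exists (i k) => n kn; apply: (@le_lt_trans _ _ (3 * 2 ^- k)); last first.
  by have := p0 k; lra.
apply: ounorm_le; first by rewrite mulr_gt0.
apply/andP; split.
  rewrite -ordN2 opprK opprB ord_subl_addr addrC.
  apply: le_trans (_ : x n + 2 ^- k *: u <= _).
    by apply: slb => _ [j _ <-]; apply: y_ub.
  by rewrite ordD2l ord_scalel ?ounit_ge0 //; have := p0 k; lra.
have yk : x (i k) <= s + (2 * 2 ^- k) *: u.
  by rewrite -ord_subl_addr; apply: sub; exists k.
have xn : x n <= 2 ^- k *: u + x (i k) by rewrite -ord_subl_addr close.
rewrite ord_subl_addr; apply: (le_trans xn).
have -> : 3 * 2 ^- k = 2 ^- k + 2 * 2 ^- k :> R by ring.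
by rewrite scalerDl -addrA ordD2l addrC.
Qed.

End OrderUnitSpaces.

(** * E as the unit interval of its space of differences *)

Section Embedding.
Context (R : realType) (E : convexEffect R).
Implicit Types (a b c : E) (r s t : R) (k l m : cone E) (x y : espan E).

Definition emb a : espan E := cinc (cemb a).
Local Notation u := (emb eone).

Lemma emb_ge0 a : 0 <= emb a. Proof. exact: cinc_ge0. Qed.

Lemma embD a b c : eadd a b = Some c -> emb a + emb b = emb c.
Proof. by move=> abc; rewrite /emb -cincD (cembD abc). Qed.

Lemma emb0 : emb ezero = 0. Proof. by rewrite /emb cemb0. Qed.

Lemma emb_act r a : 0 <= r <= 1 -> emb (cact r a) = r *: emb a.
Proof.
by move=> r01; rewrite /emb cemb_act // cinc_scale //; case/andP: r01.
Qed.

Lemma emb_inj : injective emb.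
Proof. by move=> a b /cinc_inj/cemb_inj. Qed.

Lemma emb_le a b : emb a <= emb b <-> ele a b.
Proof.
split=> [/sleP[k]|[c abc]]; last by rewrite -(embD abc) -{1}[emb a]addr0
  ordD2l emb_ge0.
rewrite /emb -cincD => /cinc_inj /(congr1 (fun l : cone E => l 1)).
rewrite cvalD !cembE => /esym /[dup] /opt_add_def[_ [c ->]] abc.
by exists c.
Qed.

Lemma emb_le1 a : emb a <= u.
Proof. exact/emb_le/ele_one. Qed.

Lemma emb_surj x : 0 <= x <= u -> exists a, emb a = x.
Proof.
move=> /andP[/span_ge0P[k ->] /sleP[l]]; rewrite -cincD => /cinc_inj /esym.
by move=> /cemb_le_one[a -> _]; exists a.
Qed.

Lemma emb_add a b : emb a + emb b <= u -> exists c, eadd a b = Some c.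
Proof.
move=> /sleP[k]; rewrite -!cincD => /cinc_inj.
move=> /(congr1 (fun l : cone E => l 1)); rewrite !cvalD !cembE => /esym.
by move=> /opt_add_def[].
Qed.

Lemma span_unit_bound x : exists n : nat, - (u *+ n) <= x <= u *+ n.
Proof.
have u0 n : 0 <= u *+ n by rewrite -scaler_nat ordlmod_scale_ge0 // emb_ge0.
have cincMn n k : cinc (k *+ n) = cinc k *+ n.
  by elim: n => [|n IHn]; rewrite ?cinc0 // !mulrS cincD IHn.
have [k [l ->]] := spanE x.
have [n [k']] := cone_bound k; have [m [l']] := cone_bound l.
move=> /(congr1 (@cinc _ _)) + /(congr1 (@cinc _ _)).
rewrite !cincD !cincMn -/u => lm kn.
have km : cinc k <= u *+ n by rewrite -kn -{1}[cinc k]addr0 ordD2l cinc_ge0.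
have {}lm : cinc l <= u *+ m by rewrite -lm -{1}[cinc l]addr0 ordD2l cinc_ge0.
exists (n + m)%N; rewrite mulrnDr; apply/andP; split.
  rewrite opprD [leLHS]addrC -[leLHS]addrC; apply: ordD; last by rewrite ordN2.
  by rewrite (le_trans _ (cinc_ge0 k)) // -oppr0 ordN2.
apply: ordD => //; rewrite (le_trans _ (u0 m)) // -oppr0 ordN2; exact: cinc_ge0.
Qed.

Lemma span_unit_bound1 x : exists2 r : R, 1 <= r & x <= r *: u.
Proof.
have [n /andP[_ xn]] := span_unit_bound x.
exists n.+1%:R; first by rewrite ler1n.
apply: (le_trans xn); rewrite -scaler_nat ord_scalel ?emb_ge0 //.
by rewrite ler_nat.
Qed.

Lemma cact_le r a b : 0 <= r <= 1 -> ele a b -> ele (cact r a) (cact r b).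
Proof.
move=> r01 /emb_le ab; apply/emb_le; rewrite !emb_act // ord_scale //.
by case/andP: r01.
Qed.

(** A bound x may lie outside the unit interval; divided by some r >= 1 it becomes an element of E.
    What remains is that scaling by 1/r preserves the supremum. *)
Lemma emb_lub (a : nat -> E) c : (forall n, ele (a n) (a n.+1)) -> is_lub a c ->
  forall x, (forall n, emb (a n) <= x) -> emb c <= x.
Proof.
move=> ai [ac ca] x ax; have [r r1 xr] := span_unit_bound1 x.
have r0 : 0 < r by apply: lt_le_trans r1.
have rn0 : r != 0 by rewrite gt_eqF.
have r01 : 0 <= r^-1 <= 1 by rewrite invr_ge0 (ltW r0) invf_le1.
have /andP[ri0 _] := r01.
have [d dx] : exists d, emb d = r^-1 *: x.
  apply: emb_surj; rewrite ordlmod_scale_ge0 ?(le_trans (emb_ge0 (a 0%N))) //=.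
  by rewrite -[u]scale1r -(mulVf rn0) -scalerA ord_scale.
have [s [sub slb]] := csup (fun n => cact_le r01 (ai n)).
have sd : emb s <= r^-1 *: x.
  rewrite -dx; apply/emb_le/slb => n; apply/emb_le.
  by rewrite emb_act // dx ord_scale.
have sc : emb s <= r^-1 *: emb c.
  by rewrite -emb_act //; apply/emb_le/slb => n; apply: cact_le.
(* Since s <= c/r, the multiple r s stays in E; it bounds all a_n, so c <= r s. *)
have [t te] : exists t : E, emb t = r *: emb s.
  apply: emb_surj; rewrite ordlmod_scale_ge0 ?emb_ge0 ?(ltW r0) //=.
  apply: le_trans (emb_le1 c); rewrite -[leRHS]scale1r -(mulfV rn0) -scalerA.
  by rewrite ord_scale // ltW.
have : emb c <= emb t.
  apply/emb_le/ca => n; apply/emb_le; rewrite te.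
  rewrite -[leLHS]scale1r -(mulfV rn0) -scalerA ord_scale ?(ltW r0) //.
  rewrite -emb_act //.
  exact/emb_le.
move=> /le_trans; apply; rewrite te -[leRHS]scale1r -(mulfV rn0) -scalerA.
by rewrite ord_scale // ltW.
Qed.

(** The hypothesis at 2^n gives (1 - 2^-n) u <= u - x, and [club1] with [emb_lub] turns this into u
    <= u - x. *)
Lemma span_archi x : (forall n : nat, x *+ n <= u) -> x <= 0.
Proof.
move=> xn; suff : u <= u - x.
  by rewrite -{1}[u]addr0 ordD2l -{1}oppr0 ordN2.
have h n : 0 <= 1 - (2 ^- n : R) <= 1.
  by have /andP[p0 p1] := pow_half_bound R n; apply/andP; split; lra.
apply: (emb_lub _ (club1 E)) => n.
  apply/emb_le; rewrite !emb_act // ord_scalel ?emb_ge0 //.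
  by rewrite lerD2l lerN2 lef_pV2 ?posrE ?exprn_gt0 // ler_eXn2l ?ltr1n.
rewrite emb_act // scalerBl scale1r ordD2l ordN2.
have p0 : 0 < (2 ^- n : R) by rewrite invr_gt0 exprn_gt0.
have -> : x = 2 ^- n *: (2 ^+ n *: x).
  by rewrite scalerA mulVf ?scale1r // expf_neq0 // pnatr_eq0.
by rewrite ord_scale ?(ltW p0) // -natrX scaler_nat.
Qed.

HB.instance Definition _ := isOrderUnitSpace.Build R (espan E)
  (emb_ge0 eone) span_unit_bound span_archi.

(** Shifting by x_0 and dividing by r puts the sequence into E, where a supremum exists; [emb_lub]
    compares it with bounds from the whole space. *)
Lemma span_sigma_complete (x : nat -> espan E) :
  {homo x : m n / (m <= n)%N >-> m <= n} -> has_ubound (range x) ->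
  exists s : espan E, supremums (range x) s.
Proof.
move=> xi [b xb]; have [r r1 br] := span_unit_bound1 (b - x 0%N).
have r0 : 0 < r by apply: lt_le_trans r1.
have rn0 : r != 0 by rewrite gt_eqF.
have ri0 : 0 <= r^-1 by rewrite invr_ge0 ltW.
have /choice[a ax] n : exists a, emb a = r^-1 *: (x n - x 0%N).
  apply: emb_surj.
  rewrite ordlmod_scale_ge0 ?ordB_ge0 ?xi //=.
  rewrite -[u]scale1r -(mulVf rn0) -scalerA ord_scale //; apply: le_trans br.
  by rewrite ordD2r; apply: xb; exists n.
have xa n : x n = x 0%N + r *: emb (a n).
  by rewrite ax scalerA mulfV // scale1r addrC subrK.
have ai n : ele (a n) (a n.+1).
  by apply/emb_le; rewrite !ax ord_scale // ordD2r xi.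
have [c cP] := csup ai; have [ac _] := cP.
exists (x 0%N + r *: emb c); split=> [_ [n _ <-]|y yx].
  by rewrite xa ordD2l ord_scale ?(ltW r0) //; apply/emb_le.
rewrite addrC -ord_subr_addr -[leRHS]scale1r -(mulfV rn0) -scalerA.
rewrite ord_scale ?(ltW r0) //; apply: (emb_lub ai cP) => n.
by rewrite ax ord_scale // ordD2r; apply: yx; exists n.
Qed.

HB.instance Definition _ := isSigmaBOUS.Build R (espan E)
  (sigma_complete_banach span_sigma_complete) span_sigma_complete.

End Embedding.

(** * Extension of maps from the unit interval *)

Section LinearMaps.
Context (R : nzRingType) (U V : lmodType R) (h : U -> V).
Hypothesis h_linear : linear h.

Lemma linD x y : h (x + y) = h x + h y.
Proof. by have := h_linear 1 x y; rewrite !scale1r. Qed.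

Lemma lin0 : h 0 = 0.
Proof. by apply: (addrI (h 0)); rewrite -linD !addr0. Qed.

Lemma linZ r x : h (r *: x) = r *: h x.
Proof. by have := h_linear r x 0; rewrite lin0 !addr0. Qed.

Lemma linB x y : h (x - y) = h x - h y.
Proof. by rewrite linD -scaleN1r linZ scaleN1r. Qed.

End LinearMaps.

Lemma scale_diff_diff (R : nzRingType) (W : lmodType R) (p q : R)
    (a b c d : W) :
  (p - q) *: (a - b) + (c - d) = (p *: a + q *: b + c) - (p *: b + q *: a + d).
Proof.
rewrite scalerBl !scalerBr opprB [X in X + (c - d)]addrACA -opprD.
by rewrite addrACA -opprD.
Qed.

Section Suprema.
Context (R : realType) (V : ordLmodType R).

Lemma supremums_affine (c : R) (z s : V) (x : nat -> V) : 0 < c ->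
  supremums (range x) s ->
  supremums (range (fun n => c *: (x n - z))) (c *: (s - z)).
Proof.
move=> c0 [sub slb]; split=> [_ [n _ <-]|b xb].
  by rewrite ord_scale ?(ltW c0) // ordD2r; apply: sub; exists n.
have cn0 : c != 0 by rewrite gt_eqF.
have -> : b = c *: (c^-1 *: b) by rewrite scalerA mulfV // scale1r.
rewrite ord_scale ?(ltW c0) // ord_subl_addr; apply: slb => _ [n _ <-].
rewrite -ord_subl_addr.
have -> : x n - z = c^-1 *: (c *: (x n - z)).
  by rewrite scalerA mulVf // scale1r.
by rewrite ord_scale ?invr_ge0 ?(ltW c0) //; apply: xb; exists n.
Qed.

End Suprema.

Section BousHoms.
Context (R : realType) (X Y : sigmaBOUSType R).

Lemma scale_interval (r : R) (x : X) : 0 < r -> 0 <= x -> x <= r *: ounit ->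
  0 <= r^-1 *: x <= ounit.
Proof.
move=> r0 x0 xr; rewrite ordlmod_scale_ge0 ?invr_ge0 ?(ltW r0) //=.
have <- : r^-1 *: (r *: (ounit : X)) = ounit.
  by rewrite scalerA mulVf ?scale1r // gt_eqF.
by rewrite ord_scale // invr_ge0 ltW.
Qed.

(** The affine map x |-> (x + r u) / 2r carries [-r u, r u] onto [0, u]; hence linear maps are
    determined on the unit interval. *)
Lemma ounit_interval_split (x : X) : exists (r : R) (y : X),
  [/\ 0 <= r, 0 <= y <= ounit & x = (2 * r) *: y - r *: ounit].
Proof.
have [r r1 /andP[rx xr]] := ounit_bound x.
have r0 : 0 < r by apply: lt_le_trans r1.
have rn : 2 * r != 0 by rewrite mulf_neq0 ?pnatr_eq0 // gt_eqF.
exists r, ((2 * r)^-1 *: (x + r *: ounit)); split; first exact: ltW.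
  apply: scale_interval; first by rewrite mulr_gt0.
    by rewrite -ord_subl_addr sub0r.
  rewrite (_ : 2 * r = r + r); last by ring.
  by rewrite scalerDl ordD2r.
by rewrite scalerA mulfV // scale1r addrK.
Qed.

Lemma bous_hom_eq (h h' : bous_hom X Y) :
  (forall x, 0 <= x <= ounit -> h x = h' x) -> h = h'.
Proof.
move=> hh; apply: bous_hom_ext; apply/funext => x.
have lh := bous_linear (bous_homP h); have lh' := bous_linear (bous_homP h').
have [r [y [_ y01 ->]]] := ounit_interval_split x.
rewrite (linB lh) (linB lh') !(linZ lh) !(linZ lh') !hh //.
by rewrite ounit_ge0 lexx.
Qed.

Variable phi : X -> Y.
Hypothesis phiD : forall x y,
  0 <= x -> 0 <= y -> x + y <= ounit -> phi (x + y) = phi x + phi y.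
Hypothesis phiZ : forall (r : R) x,
  0 <= r <= 1 -> 0 <= x <= ounit -> phi (r *: x) = r *: phi x.
Hypothesis phi01 : forall x, 0 <= x <= ounit -> 0 <= phi x <= ounit.
(** Only bounds from the unit interval of [Y] are tested, as suprema in an effect algebra provide no
    more; [ext_normal] rescales arbitrary bounds. *)
Hypothesis phi_sup : forall (x : nat -> X) (s : X),
  (forall n, 0 <= x n <= ounit) -> 0 <= s <= ounit ->
  {homo x : m n / (m <= n)%N >-> m <= n} -> supremums (range x) s ->
  forall b, 0 <= b <= ounit -> (forall n, phi (x n) <= b) -> phi s <= b.

Definition ubound_of (x : X) : R := s2val (cid2 (ounit_bound x)).

Lemma ubound_ofP x : 0 < ubound_of x /\ x <= ubound_of x *: ounit.
Proof.
rewrite /ubound_of; case: cid2 => r /= r1 /andP[_ xr].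
by split=> //; apply: lt_le_trans r1.
Qed.

Definition ext_pos (x : X) : Y := ubound_of x *: phi ((ubound_of x)^-1 *: x).

(** For s <= t the element x/t is the multiple s/t of x/s, and [phi] commutes with that factor. *)
Lemma ext_posE (r : R) x : 0 < r -> 0 <= x -> x <= r *: ounit ->
  ext_pos x = r *: phi (r^-1 *: x).
Proof.
have le (s t : R) : 0 < s -> s <= t -> 0 <= x -> x <= s *: ounit ->
    s *: phi (s^-1 *: x) = t *: phi (t^-1 *: x).
  move=> s0 st x0 xs; have t0 := lt_le_trans s0 st.
  have -> : t^-1 *: x = (s / t) *: (s^-1 *: x).
    by rewrite scalerA mulrAC divff ?mul1r // gt_eqF.
  have st1 : 0 <= s / t <= 1.
    by rewrite divr_ge0 ?(ltW s0) ?(ltW t0) //= ler_pdivrMr // mul1r.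
  rewrite (phiZ st1 (scale_interval s0 x0 xs)).
  by rewrite scalerA [t * _]mulrC divfK // gt_eqF.
move=> r0 x0 xr; have [s0 xs] := ubound_ofP x; rewrite /ext_pos.
have [h|/ltW h] := leP (ubound_of x) r; first exact: le.
by apply/esym/le.
Qed.

Lemma ext_posD x y : 0 <= x -> 0 <= y ->
  ext_pos (x + y) = ext_pos x + ext_pos y.
Proof.
move=> x0 y0; have [[r0 xr] [s0 ys]] := (ubound_ofP x, ubound_ofP y).
set r := ubound_of x in r0 xr *; set s := ubound_of y in s0 ys *.
have t0 : 0 < r + s by apply: addr_gt0.
have xy : x + y <= (r + s) *: ounit by rewrite scalerDl ordD.
have rs0 t : 0 <= t -> 0 <= t *: (ounit : X).
  by move=> ?; rewrite ordlmod_scale_ge0 // ounit_ge0.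
have xt : x <= (r + s) *: ounit.
  by rewrite (le_trans xr) // ord_scalel ?ounit_ge0 // lerDl ltW.
have yt : y <= (r + s) *: ounit.
  by rewrite (le_trans ys) // ord_scalel ?ounit_ge0 // lerDr ltW.
have xy0 : 0 <= x + y by rewrite -(addr0 0) ordD.
have /andP[hx _] := scale_interval t0 x0 xt.
have /andP[hy _] := scale_interval t0 y0 yt.
have /andP[_ hxy] := scale_interval t0 xy0 xy.
rewrite (ext_posE t0 xy0 xy) (ext_posE t0 x0 xt) (ext_posE t0 y0 yt).
by rewrite scalerDr phiD -?scalerDr.
Qed.

Lemma phi0 : phi 0 = 0.
Proof.
apply: (addrI (phi 0)); rewrite -phiD ?addr0 ?lexx //; exact: ounit_ge0.
Qed.

Lemma ext_pos_interval x : 0 <= x <= ounit -> ext_pos x = phi x.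
Proof.
move=> /andP[x0 x1]; rewrite (@ext_posE 1) ?scale1r ?invr1 ?scale1r //.
Qed.

Lemma ext_posZ (r : R) x : 0 <= r -> 0 <= x ->
  ext_pos (r *: x) = r *: ext_pos x.
Proof.
move=> r0 x0; have [->|rn0] := eqVneq r 0.
  by rewrite !scale0r ext_pos_interval ?phi0 // lexx ounit_ge0.
have rp : 0 < r by rewrite lt0r rn0.
have [s0 xs] := ubound_ofP x; set s := ubound_of x in s0 xs *.
rewrite (@ext_posE (r * s)) ?mulr_gt0 ?ordlmod_scale_ge0 //; last first.
  by rewrite -scalerA ord_scale.
rewrite (ext_posE s0) // scalerA; congr (_ *: phi _).
by rewrite scalerA invfM mulrAC mulVf // mul1r.
Qed.

Lemma ext_pos_ge0 x : 0 <= x -> 0 <= ext_pos x.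
Proof.
move=> x0; have [s0 xs] := ubound_ofP x; rewrite /ext_pos.
have /andP[h _] := phi01 (scale_interval s0 x0 xs).
by rewrite ordlmod_scale_ge0 // ltW.
Qed.

(** Adding [ubound_of (- x)] units makes x nonnegative; [ext_diff] shows that every decomposition
    into nonnegative elements gives the same value. *)
Definition ext (x : X) : Y :=
  ext_pos (x + ubound_of (- x) *: ounit) - ext_pos (ubound_of (- x) *: ounit).

Lemma ext_diff a b : 0 <= a -> 0 <= b -> ext (a - b) = ext_pos a - ext_pos b.
Proof.
move=> a0 b0; have [r0] := ubound_ofP (- (a - b)).
rewrite /ext; set r := ubound_of _ => hr.
have ru0 : 0 <= r *: (ounit : X) by rewrite ordlmod_scale_ge0 ?ounit_ge0 ?ltW.
have x0 : 0 <= a - b + r *: ounit.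
  by rewrite -ord_subl_addr sub0r -ordN2 opprK.
apply/eqP; rewrite subr_eq [eqbRHS]addrAC eq_sym subr_eq -!ext_posD //.
by rewrite addrAC subrK.
Qed.

Lemma pos_diff (x : X) : exists a b : X, [/\ 0 <= a, 0 <= b & x = a - b].
Proof.
have [r [y [r0 /andP[y0 _] ->]]] := ounit_interval_split x.
exists ((2 * r) *: y), (r *: ounit).
by split=> //; rewrite ordlmod_scale_ge0 ?ounit_ge0 // mulr_ge0.
Qed.

Lemma ext_linear : linear ext.
Proof.
move=> r x y; have [p [q [p0 q0 ->]]] := real_diff r.
have [[a [b [a0 b0 ->]]] [c [d [c0 d0 ->]]]] := (pos_diff x, pos_diff y).
have s0 (s : R) (z : X) : 0 <= s -> 0 <= z -> 0 <= s *: z.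
  exact: ordlmod_scale_ge0.
have D0 (z w : X) : 0 <= z -> 0 <= w -> 0 <= z + w.
  by move=> *; rewrite -(addr0 0) ordD.
rewrite scale_diff_diff !ext_diff ?D0 ?s0 // !ext_posD ?D0 ?s0 // !ext_posZ //.
by rewrite scale_diff_diff.
Qed.

Lemma ext_interval x : 0 <= x <= ounit -> ext x = phi x.
Proof.
move=> /[dup] /andP[x0 _] x01.
have e0 : 0 <= (0 : X) <= ounit by rewrite lexx ounit_ge0.
by rewrite -[x in LHS]subr0 ext_diff // !ext_pos_interval // phi0 subr0.
Qed.

Lemma ext_ge0 x : 0 <= x -> 0 <= ext x.
Proof.
move=> x0; have e0 : 0 <= (0 : X) <= ounit by rewrite lexx ounit_ge0.
rewrite -[x]subr0 ext_diff // [ext_pos 0]ext_pos_interval // phi0 subr0.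
exact: ext_pos_ge0.
Qed.

Lemma ext_le : {homo ext : x y / x <= y}.
Proof.
move=> x y; rewrite -ordB_ge0 => /ext_ge0.
by rewrite (linB ext_linear) ordB_ge0.
Qed.

Lemma ext_normal (x : nat -> X) (s : X) :
  {homo x : m n / (m <= n)%N >-> m <= n} -> has_ubound (range x) ->
  supremums (range x) s -> supremums (range (ext \o x)) (ext s).
Proof.
move=> xi _ sP; have [sub slb] := sP; split=> [_ [n _ <-]|b xb].
  by apply/ext_le/sub; exists n.
have x0s : x 0%N <= s by apply: sub; exists 0%N.
have x0b : ext (x 0%N) <= b by apply: xb; exists 0%N.
have [r1 sr] := ubound_ofP (s - x 0%N).
have [r2 r21 /andP[_ br]] := ounit_bound (b - ext (x 0%N)).
have r20 : 0 < r2 by apply: lt_le_trans r21.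
(* One factor serves domain and codomain: after shifting by x_0 and dividing by t, the sequence, its
   supremum and the bound b all lie in unit intervals, where [phi_sup] applies. *)
set r := ubound_of _ in r1 sr; pose t := r + r2.
have t0 : 0 < t by apply: addr_gt0.
have tn0 : t != 0 by rewrite gt_eqF.
have ti0 : 0 <= t^-1 by rewrite invr_ge0 ltW.
have st : s - x 0%N <= t *: ounit.
  by rewrite (le_trans sr) // ord_scalel ?ounit_ge0 // lerDl ltW.
have bt : b - ext (x 0%N) <= t *: ounit.
  by rewrite (le_trans br) // ord_scalel ?ounit_ge0 // lerDr ltW.
have s01 : 0 <= t^-1 *: (s - x 0%N) <= ounit.
  by apply: scale_interval => //; rewrite ordB_ge0.
have b01 : 0 <= t^-1 *: (b - ext (x 0%N)) <= ounit.
  rewrite ordlmod_scale_ge0 ?ordB_ge0 //=.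
  have <- : t^-1 *: (t *: (ounit : Y)) = ounit.
    by rewrite scalerA mulVf ?scale1r.
  by rewrite ord_scale.
pose y n := t^-1 *: (x n - x 0%N).
have y01 n : 0 <= y n <= ounit.
  apply: scale_interval => //; rewrite ?ordB_ge0 ?xi //.
  by rewrite (le_trans _ st) // ordD2r; apply: sub; exists n.
have yi : {homo y : m n / (m <= n)%N >-> m <= n}.
  by move=> m n mn; rewrite /y ord_scale // ordD2r xi.
have tip : 0 < t^-1 by rewrite invr_gt0.
have := phi_sup y01 s01 yi (supremums_affine (x 0%N) tip sP) b01.
rewrite -ext_interval // (linZ ext_linear) (linB ext_linear) => h.
rewrite -(ordD2r (- ext (x 0%N))) -[leLHS]scale1r -[leRHS]scale1r -(mulfV tn0).
rewrite -!scalerA ord_scale ?(ltW t0) //; apply: h => n.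
rewrite -ext_interval // (linZ ext_linear) (linB ext_linear) ord_scale //.
by rewrite ordD2r; apply: xb; exists n.
Qed.

Lemma bous_hom_exists :
  exists h : bous_hom X Y, forall x, 0 <= x <= ounit -> h x = phi x.
Proof.
have hP : is_bous_hom ext.
  split; [exact: ext_linear|exact: ext_ge0| |exact: ext_normal].
  have u01 : 0 <= (ounit : X) <= ounit by rewrite lexx ounit_ge0.
  by rewrite ext_interval //; case/andP: (phi01 u01).
by exists (BousHom hP) => x /ext_interval.
Qed.

End BousHoms.

(** * Predicates and scalars *)

Lemma iso_efsum (E E' : effect_sig) (f : E -> E') (s : seq E) :
  is_effect_iso f -> efsum (map f s) = omap f (efsum s).
Proof.
move=> fP; elim: s => [|a s IHs] /=; first by rewrite (eiso_zero fP).
by rewrite IHs; case: (efsum s) => //= b; rewrite (eiso_add fP).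
Qed.

Lemma iso_ele (E E' : effect_sig) (f : E -> E') a b :
  is_effect_iso f -> ele (f a) (f b) <-> ele a b.
Proof.
move=> fP; have [g fK gK] := eiso_bij fP; split=> [[c]|[c abc]].
  rewrite -(gK c) (eiso_add fP); case e : (eadd a (g c)) => [d|] //= [] db.
  by exists (g c); rewrite e -(fK d) db fK.
by exists (f c); rewrite (eiso_add fP) abc.
Qed.

Lemma iso_ecsum (E E' : effect_sig) (f : E -> E') (J : countType)
    (x : J -> E) s :
  is_effect_iso f -> is_ecsum (f \o x) (f s) <-> is_ecsum x s.
Proof.
move=> fP; have [g fK gK] := eiso_bij fP.
have part (F : {fset J}) : efsum [seq (f \o x) j | j <- enum_fset F]
    = omap f (efsum [seq x j | j <- enum_fset F]).
  by rewrite -iso_efsum // -map_comp.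
split=> -[def ub lb]; split=> [F|F t e|b bP].
- by have := def F; rewrite part; case: efsum.
- by apply/(iso_ele _ _ fP)/(ub F); rewrite part e.
- apply/(iso_ele _ _ fP)/lb => F t; rewrite part.
  by case e : efsum => [w|] //= [<-]; apply/(iso_ele _ _ fP)/(bP F).
- by rewrite part; have := def F; case: efsum.
- rewrite part in e; case e' : efsum e => [w|] //= [<-].
  by apply/(iso_ele _ _ fP)/(ub F).
- rewrite -(gK b); apply/(iso_ele _ _ fP)/lb => F t e.
  by apply/(iso_ele _ _ fP); rewrite gK; apply: (bP F); rewrite part e.
Qed.

(** * The action of [0,1] on predicates *)

Section Scalars.
Context (R : realType) (C : sigmaEffectus).
Context (theta : unit_interval R -> scalars C).
Hypothesis theta_iso : is_effect_monoid_iso theta.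
Local Notation I := (eff_unit C).
Implicit Types (r s : R).

(** Reals outside [0,1] go to the default 0, which makes [scal] total on [R]. *)
Definition clip r : Defs.interval (1 : R) :=
  insubd (exist _ 0 (interval0P ler01)) r.

Lemma clipK r : 0 <= r <= 1 -> val (clip r) = r.
Proof. by move=> r01; rewrite insubdK. Qed.

Definition scal r : mor I I := theta (clip r).

Lemma scal_surj (s : mor I I) : exists2 r, 0 <= r <= 1 & s = scal r.
Proof.
have [g gK thK] := eiso_bij (emiso_effect theta_iso).
exists (val (g s : Defs.interval (1 : R))); first exact: (valP (g s)).
rewrite /scal -{1}(thK s); congr theta; apply: val_inj.
by rewrite clipK // (valP (g s)).
Qed.

Lemma scal1_truth : scal 1 = truth I.
Proof.
rewrite -[RHS](eiso_one (emiso_effect theta_iso)); congr theta.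
by apply: val_inj; rewrite clipK // ler01 lexx.
Qed.

Lemma scalM r s : 0 <= r <= 1 -> 0 <= s <= 1 ->
  scal (r * s) = scal r \oc scal s.
Proof.
move=> r01 s01; rewrite -[RHS](emiso_mul theta_iso); congr theta.
apply: val_inj; rewrite /= !clipK //.
by case/andP: r01 => *; case/andP: s01 => *; rewrite mulr_ge0 // mulr_ile1.
Qed.

(** The identity is some [scal r], so [scal 1] composed with it is [scal (1 * r)], that is, the
    identity itself. *)
Lemma scal1 : scal 1 = mid I.
Proof.
have [r r01 rI] := scal_surj (mid I).
have h : 0 <= (1 : R) <= 1 by rewrite ler01 lexx.
by rewrite -[LHS]mcomp_idr rI -scalM // mul1r.
Qed.

Lemma scal_padd r s t : 0 <= r <= 1 -> 0 <= s <= 1 -> 0 <= t <= 1 ->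
  padd (pac_pam I I) (scal r) (scal s) = Some (scal t) <-> r + s = t.
Proof.
move=> r01 s01 t01.
have := eiso_add (emiso_effect theta_iso) (clip r) (clip s).
rewrite /= !clipK // => ->.
have [g gK _] := eiso_bij (emiso_effect theta_iso).
split.
  case: insubP => [w _ we|] //= [] /(can_inj gK) wt.
  by rewrite -we wt clipK.
move=> rst; rewrite rst insubT /=; congr (Some (theta _)).
by apply: val_inj; rewrite clipK.
Qed.

Lemma scal_ele r s : 0 <= r <= 1 -> 0 <= s <= 1 ->
  @ele (scalars C) (scal r) (scal s) <-> r <= s.
Proof.
move=> r01 s01; split=> [[c]|rs].
  have [t t01 ->] := scal_surj c => /scal_padd <- //.
  by rewrite lerDl; case/andP: t01.
have h : 0 <= s - r <= 1.
  by case/andP: r01 => *; case/andP: s01 => *; apply/andP; split; lra.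
by exists (scal (s - r)); apply/scal_padd => //; rewrite addrC subrK.
Qed.

Context (A : C).
Let S := pac_pam A I.
Definition pred_ea := EffectAlgebra (eff_effect_algebra A).

Definition pact r (p : pred_ea) : pred_ea := scal r \oc p.

Lemma pact1 p : pact 1 p = p.
Proof. by rewrite /pact scal1 mcomp_idl. Qed.

Lemma pactA r s p : 0 <= r <= 1 -> 0 <= s <= 1 ->
  pact r (pact s p) = pact (r * s) p.
Proof. by move=> r01 s01; rewrite /pact mcompA -scalM. Qed.

Lemma pactDl r s p : 0 <= r -> 0 <= s -> r + s <= 1 ->
  eadd (pact r p) (pact s p) = Some (pact (r + s) p).
Proof.
move=> r0 s0 rs; apply: (padd_map (pac_comp_additivel p)).
by apply/scal_padd => //; apply/andP; split; lra.
Qed.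

Lemma pactDr r (p q t : pred_ea) : 0 <= r <= 1 -> eadd p q = Some t ->
  eadd (pact r p) (pact r q) = Some (pact r t).
Proof. by move=> _; apply: (padd_map (pac_comp_additiver (scal r))). Qed.

Lemma pred_sup (a : nat -> pred_ea) : (forall n, ele (a n) (a n.+1)) ->
  exists s : pred_ea, is_lub a s.
Proof. exact: (increasing_lub (eff_effect_algebra A)). Qed.

Lemma pow_half_compl n : 0 <= 1 - (2 ^- n : R) <= 1.
Proof.
by have /andP[p0 p1] := pow_half_bound R n; apply/andP; split; lra.
Qed.

Lemma scal_lub1 : @is_lub (scalars C) (fun n => scal (1 - 2 ^- n)) (scal 1).
Proof.
have h1 : 0 <= (1 : R) <= 1 by rewrite ler01 lexx.
split=> [n|b bP].
  apply/scal_ele => //; first exact: pow_half_compl.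
  by case/andP: (pow_half_compl n).
have [r r01 br] := scal_surj b; rewrite br in bP *.
apply/scal_ele => //; rewrite leNgt; apply/negP => r1.
(* Halving 1 - r forces 1 - 2^-n > r, against r being a bound. *)
have [n rn] : exists n, 2 ^- n <= (1 - r) / 2.
  by apply: pow_half_le; rewrite divr_gt0 // subr_gt0.
have /scal_ele := bP n; move=> /(_ (pow_half_compl n) r01) h.
by lra.
Qed.

(** The supremum is known for scalars; precomposition with the truth predicate of [A] is
    sigma-additive and transports it. *)
Lemma pred_lub1 : @is_lub pred_ea (fun n => pact (1 - 2 ^- n) eone) eone.
Proof.
have := @additive_lub _ _ _ _ (truth I) (truth A) _
  (fun n => scal (1 - 2 ^- n)) (scal 1) (eff_effect_algebra I)
  (eff_effect_algebra A) (pac_comp_additivel (truth A)) _ scal_lub1.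
rewrite scal1 mcomp_idl; apply => n.
apply/(scal_ele (pow_half_compl n) (pow_half_compl n.+1)).
rewrite lerD2l lerN2 lef_pV2 ?posrE ?exprn_gt0 // ler_eXn2l ?ltr1n //.
Qed.

Definition pred_ce : convexEffect R :=
  @ConvexEffect R pred_ea pact pact1 pactA pactDl pactDr pred_sup pred_lub1.

End Scalars.

(** * The functor *)

Section Coproducts.
Context (C : sigmaEffectus) (J : countType) (B : J -> C) (S : C).
Context (k : forall j, mor (B j) S).
Hypothesis kP : is_coproduct k.
Local Notation I := (eff_unit C).

Lemma coproduct_ext (X : C) (f g : mor S X) :
  (forall j, f \oc k j = g \oc k j) -> f = g.
Proof.
move=> fg; have [h [_ hu]] := kP (fun j => f \oc k j).
by rewrite -(hu f) ?(hu g) // => j; rewrite fg.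
Qed.

Lemma padd0 (A : C) (p : mor A I) :
  padd (pac_pam A I) (pzero (pac_pam A I)) p = Some p.
Proof. exact: (eadd0 (eff_effect_algebra A) p). Qed.

Lemma paddC (A : C) (p q : mor A I) :
  padd (pac_pam A I) p q = padd (pac_pam A I) q p.
Proof. exact: (eaddC (eff_effect_algebra A) p q). Qed.

(** Untying makes the two coprojected predicates summable; projecting their sum recovers p and q,
    since the cross terms vanish. *)
Lemma untie (A : C) (p q c : mor A I) : padd (pac_pam A I) p q = Some c ->
  exists t : mor A (coprod (pac_coprod C) (fun _ : bool => I)), forall b : bool,
    pproj (pac_coprod C) (pac_pam (s := C)) (fun=> I) b \oc t
    = if b then p else q.
Proof.
move=> pq; have /pac_untying : perp (pac_pam A I) p q by rewrite /perp pq.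
rewrite /perp; case e : (padd _ _ _) => [t|] // _; exists t => b.
have := padd_map (pac_comp_additiver
  (pproj (pac_coprod C) (pac_pam (s := C)) (fun=> I) b)) e.
rewrite !mcompA; case: b.
  rewrite pproj_kappa pproj_kappa_neq // mcomp_idl.
  rewrite (pzero_map (pac_comp_additivel q)) paddC padd0.
  by case.
rewrite pproj_kappa pproj_kappa_neq // mcomp_idl.
rewrite (pzero_map (pac_comp_additivel p)) padd0.
by case.
Qed.

(** The untied components assemble into one map [t0] on S whose projections agree with p and q on
    every summand, so p and q are compatible. *)
Lemma coproduct_padd (p q : mor S I) (c : forall j, mor (B j) I) :
  (forall j, padd (pac_pam (B j) I) (p \oc k j) (q \oc k j) = Some (c j)) ->
  exists s, padd (pac_pam S I) p q = Some s /\ forall j, s \oc k j = c j.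
Proof.
move=> pq; pose t j := sval (cid (untie (pq j))).
have tE j b : pproj (pac_coprod C) (pac_pam (s := C)) (fun=> I) b \oc t j =
    if b then p \oc k j else q \oc k j by rewrite /t; case: cid.
have [t0 [t0E _]] := kP t.
have : isSome (padd (pac_pam S I) p q).
  apply: pac_compatible_sum; exists t0 => b; apply: coproduct_ext => j.
  by rewrite -mcompA t0E tE; case: b.
case e : (padd _ p q) => [s|] // _; exists s; split=> // j.
by have := padd_map (pac_comp_additivel (k j)) e; rewrite pq => -[].
Qed.

(** The componentwise differences assemble into one predicate on S, which added to p gives q. *)
Lemma coproduct_ele (p q : mor S I) :
  (forall j, @ele (pred_ea (B j)) (p \oc k j) (q \oc k j)) ->
  @ele (pred_ea S) p q.
Proof.
move=> pq; have [t [tE _]] := kP (fun j => sval (cid (pq j))).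
have [|s [ps sk]] := @coproduct_padd p t (fun j => q \oc k j).
  by move=> j; rewrite tE; case: cid.
by exists t; rewrite /= ps (coproduct_ext sk).
Qed.

End Coproducts.

(** * Spaces of predicates and the representing functor *)

Section Representation.
Context (R : realType) (C : sigmaEffectus).
Context (theta : unit_interval R -> scalars C).
Hypothesis theta_iso : is_effect_monoid_iso theta.
Local Notation I := (eff_unit C).
Implicit Types (A B : C).

Definition pred_space A : sigmaBOUSType R := espan (pred_ce theta_iso A).

Definition pemb A (p : mor A I) : pred_space A := emb (p : pred_ce theta_iso A).

Lemma pemb01 A (p : mor A I) : 0 <= pemb p <= ounit.
Proof. by rewrite emb_ge0 /=; apply: emb_le1. Qed.

Lemma pemb_surj A (x : pred_space A) : 0 <= x <= ounit -> exists p, x = pemb p.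
Proof. by move=> /emb_surj[p <-]; exists p. Qed.

Lemma pembD A (p q c : mor A I) : padd (pac_pam A I) p q = Some c ->
  pemb p + pemb q = pemb c.
Proof. by move=> pq; apply: embD. Qed.

Lemma pemb_act A (r : R) (p : mor A I) : 0 <= r <= 1 ->
  pemb (scal theta r \oc p) = r *: pemb p.
Proof. by move=> r01; rewrite -emb_act. Qed.

Lemma pemb_padd A (p q : mor A I) : pemb p + pemb q <= ounit ->
  exists c, padd (pac_pam A I) p q = Some c.
Proof. by move=> /emb_add. Qed.

Lemma pemb_le A (p q : mor A I) : pemb p <= pemb q <-> @ele (pred_ea A) p q.
Proof. exact: emb_le. Qed.

Lemma pemb_inj A : injective (@pemb A).
Proof. by move=> p q /emb_inj. Qed.

Definition pemb_inv A (x : pred_space A) : mor A I :=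
  if pselect (exists p, x = pemb p) is left e then sval (cid e)
  else pzero (pac_pam A I).

Lemma pembK A : cancel (@pemb A) (@pemb_inv A).
Proof.
move=> p; rewrite /pemb_inv; case: pselect => [e|[]]; last by exists p.
by case: cid => q /= /pemb_inj.
Qed.

(** Precomposition with f is sigma-additive, so it is additive and, by [additive_lub], preserves
    suprema of predicates; [bous_hom_exists] extends it. *)
Lemma pull_exists A B (f : mor A B) :
  exists h : bous_hom (pred_space B) (pred_space A),
    forall p, h (pemb p) = pemb (p \oc f).
Proof.
have [||||h hE] := @bous_hom_exists _ _ _ (fun x => pemb (pemb_inv x \oc f)).
- move=> x y x0 y0 xy.
  have [p xp] : exists p, x = pemb p.
    by apply: pemb_surj; rewrite x0 (le_trans _ xy) // -{1}[x]addr0 ordD2l.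
  have [q yq] : exists q, y = pemb q.
    by apply: pemb_surj; rewrite y0 (le_trans _ xy) // -{1}[y]add0r ordD2r.
  move: xy; rewrite xp yq => /pemb_padd[c pq]; rewrite (pembD pq) !pembK.
  by rewrite (pembD (padd_map (pac_comp_additivel f) pq)).
- move=> r x r01 /pemb_surj[p ->].
  by rewrite -(pemb_act p r01) !pembK -mcompA pemb_act.
- by move=> x _; apply: pemb01.
- move=> x s x01 s01 xi [sub slb] b b01 xb.
  have /choice[p xp] n := pemb_surj (x01 n).
  have [q qs] := pemb_surj s01; have [t tb] := pemb_surj b01.
  (* A supremum in the space, tested against predicates only, is a least upper bound in the effect
     algebra. *)
  have pq : @is_lub (pred_ea B) p q.
    split=> [n|c pc]; apply/pemb_le.
      by rewrite -xp -qs; apply: sub; exists n.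
    by rewrite -qs; apply: slb => _ [n _ <-]; rewrite xp; apply/pemb_le.
  have pi n : @ele (pred_ea B) (p n) (p n.+1) by apply/pemb_le; rewrite -!xp xi.
  have [_] := additive_lub (eff_effect_algebra B) (eff_effect_algebra A)
    (pac_comp_additivel f) pi pq.
  rewrite tb qs pembK => h; apply/pemb_le/h => n; apply/pemb_le.
  by have := xb n; rewrite xp tb pembK.
by exists h => p; rewrite hE ?pemb01 // pembK.
Qed.

Definition pull A B (f : mor A B) := sval (cid (pull_exists f)).

Lemma pullE A B (f : mor A B) (p : mor B I) : pull f (pemb p) = pemb (p \oc f).
Proof. by rewrite /pull; case: cid => h /= ->. Qed.

Lemma pred_hom_eq A (X : sigmaBOUSType R) (h h' : bous_hom (pred_space A) X) :
  (forall p, h (pemb p) = h' (pemb p)) -> h = h'.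
Proof. by move=> hh; apply: bous_hom_eq => x /pemb_surj[p ->]. Qed.

Lemma pull_id A : pull (mid A) = bous_id (pred_space A).
Proof. by apply: pred_hom_eq => p; rewrite pullE mcomp_idr. Qed.

Lemma pull_comp A B D (g : mor B D) (f : mor A B) :
  pull (g \oc f) = bous_comp (pull f) (pull g).
Proof. by apply: pred_hom_eq => p; rewrite /= !pullE mcompA. Qed.

Definition pred_functor : functor C (sigmaBOUSop R) :=
  @Functor C (op (sigmaBOUS R)) pred_space pull pull_id pull_comp.

Lemma pred_functor_faithful : predicate_separated C -> faithful pred_functor.
Proof.
move=> sep A B f g /= fg; apply: sep => p; apply: (@pemb_inj A).
by rewrite -!pullE fg.
Qed.

Lemma ounit_scale A (r : R) : 0 <= r <= 1 ->
  r *: (ounit : pred_space A) = pemb (scal theta r \oc truth A).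
Proof. by move=> r01; rewrite pemb_act. Qed.

Lemma ounit_scale_unit (r : R) : 0 <= r <= 1 ->
  r *: (ounit : pred_space I) = pemb (scal theta r).
Proof.
by move=> r01; rewrite ounit_scale // -(scal1_truth theta_iso) (scal1 theta_iso)
  mcomp_idr.
Qed.

Lemma pemb_scal_le (r s : R) : 0 <= r <= 1 -> 0 <= s <= 1 ->
  pemb (scal theta r) <= pemb (scal theta s) -> r <= s.
Proof. by move=> r01 s01 /pemb_le/(scal_ele theta_iso r01 s01). Qed.

Definition scal_of (x : pred_space I) : R :=
  if pselect (exists2 r : R, 0 <= r <= 1 & x = pemb (scal theta r)) is left e
  then s2val (cid2 e) else 0.

Lemma scal_ofE (r : R) : 0 <= r <= 1 -> scal_of (pemb (scal theta r)) = r.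
Proof.
move=> r01; rewrite /scal_of; case: pselect => [e|[]]; last by exists r.
case: cid2 => s /= s01 rs; apply/le_anti/andP; split.
  by apply: (pemb_scal_le s01 r01); rewrite rs lexx.
by apply: (pemb_scal_le r01 s01); rewrite rs lexx.
Qed.

Lemma scal_of_surj (x : pred_space I) : 0 <= x <= ounit ->
  exists2 r : R, 0 <= r <= 1 & x = pemb (scal theta r).
Proof.
move=> /pemb_surj[p ->]; have [r r01 ->] := scal_surj theta_iso p.
by exists r.
Qed.

(** Every predicate on the unit object is a real multiple of the truth, and reading off the factor
    inverts the map from the real line; this will compare the unit objects. *)
Lemma unit_hom_exists : exists h : bous_hom (pred_space I) R^o,
  forall r : R, 0 <= r <= 1 -> h (pemb (scal theta r)) = r.
Proof.
have [||||h hE] := @bous_hom_exists R (pred_space I) R^o (scal_of : _ -> R^o).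
- move=> x y x0 y0 xy.
  have [r r01 xr] : exists2 r : R, 0 <= r <= 1 & x = pemb (scal theta r).
    by apply: scal_of_surj; rewrite x0 (le_trans _ xy) // -{1}[x]addr0 ordD2l.
  have [s s01 ys] : exists2 r : R, 0 <= r <= 1 & y = pemb (scal theta r).
    by apply: scal_of_surj; rewrite y0 (le_trans _ xy) // -{1}[y]add0r ordD2r.
  move: xy; rewrite xr ys => /pemb_padd[c rs]; rewrite (pembD rs).
  have [t t01 ct] := scal_surj theta_iso c; rewrite ct in rs *.
  by rewrite !scal_ofE // -(scal_padd theta_iso r01 s01 t01).1.
- move=> r x r01 /scal_of_surj[s s01 ->]; rewrite -(pemb_act _ r01).
  rewrite -(scalM theta_iso r01 s01) !scal_ofE //.
  by case/andP: r01 => *; case/andP: s01 => *; rewrite mulr_ge0 // mulr_ile1.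
- by move=> x /scal_of_surj[r r01 ->]; rewrite scal_ofE.
- move=> x s x01 s01 xi [sub slb] b b01 xb.
  have [r r01 sr] := scal_of_surj s01; rewrite sr scal_ofE //.
  apply: pemb_scal_le => //; rewrite -sr; apply: slb => _ [n _ <-].
  have [t t01 xt] := scal_of_surj (x01 n); rewrite xt.
  apply/pemb_le/(scal_ele theta_iso t01 b01).
  by have := xb n; rewrite xt scal_ofE.
by exists h => r r01; rewrite hE ?pemb01 // scal_ofE.
Qed.

Lemma bous_hom_interval (X Y : sigmaBOUSType R) (h : bous_hom X Y) x :
  0 <= x <= ounit -> 0 <= h x <= ounit.
Proof.
have [_ pos sub _] := bous_homP h; move=> /andP[x0 x1].
by rewrite pos //=; apply: le_trans sub; apply: bous_le.
Qed.

(** On the unit interval each [f j x] is a predicate on [B j]; the universal property of S joins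
    these into one predicate [g x], and the map so obtained extends. *)
Lemma pred_tuple_exists (J : countType) (B : J -> C) (S : C)
    (k : forall j, mor (B j) S) (X : sigmaBOUSType R)
    (f : forall j, bous_hom X (pred_space (B j))) :
  is_coproduct k ->
  exists h : bous_hom X (pred_space S),
    forall j, bous_comp (pull (k j)) h = f j.
Proof.
move=> kP.
have /choice[g gE] x :
    exists p : mor S I, forall j, p \oc k j = pemb_inv (f j x).
  by have [p [pE _]] := kP I (fun j => pemb_inv (f j x)); exists p.
have fE x j : 0 <= x <= ounit -> f j x = pemb (g x \oc k j).
  by move=> /(bous_hom_interval (f j))/pemb_surj[p fp]; rewrite gE fp pembK.
have lf j := bous_linear (bous_homP (f j)).
have [||||h hE] := @bous_hom_exists _ _ _ (fun x => pemb (g x)).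
- move=> x y x0 y0 xy.
  have x01 : 0 <= x <= ounit.
    by rewrite x0 (le_trans _ xy) // -{1}[x]addr0 ordD2l.
  have y01 : 0 <= y <= ounit.
    by rewrite y0 (le_trans _ xy) // -{1}[y]add0r ordD2r.
  have xy01 : 0 <= x + y <= ounit by rewrite xy -(addr0 0) ordD.
  have [j|s [pq sE]] := coproduct_padd kP (p := g x) (q := g y)
    (c := fun j => g (x + y) \oc k j).
    have := fE _ j xy01; rewrite (linD (lf j)) !fE // => fxy.
    have [|c cE] := @pemb_padd _ (g x \oc k j) (g y \oc k j).
      by rewrite fxy; case/andP: (pemb01 (g (x + y) \oc k j)).
    by rewrite cE; move: fxy; rewrite (pembD cE) => /pemb_inj ->.
  by rewrite (pembD pq) (coproduct_ext kP sE).
- move=> r x r01 x01; rewrite -pemb_act //; congr pemb.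
  apply: (coproduct_ext kP) => j; apply: (@pemb_inj (B j)).
  rewrite -mcompA pemb_act // -!fE ?(linZ (lf j)) //.
  case/andP: r01 => r0 r1; case/andP: x01 => x0 x1.
  rewrite ordlmod_scale_ge0 //= (le_trans _ x1) // -[leRHS]scale1r.
  exact: ord_scalel.
- by move=> x _; apply: pemb01.
- move=> x s x01 s01 xi sP b /pemb_surj[q ->] xq.
  (* The order on the coproduct is componentwise, so the bound is checked in each [B j], where [f j]
     is sigma-normal. *)
  apply/pemb_le/(coproduct_ele kP) => j; apply/pemb_le; rewrite -fE //.
  have [_ _ _ nf] := bous_homP (f j).
  have [_] := nf x s xi (ex_intro _ s sP.1) sP; apply => _ [n _ <-] /=.
  rewrite fE // -!pullE; apply: bous_le; exact: xq.
exists h => j; apply: bous_hom_eq => x x01.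
by rewrite /= hE // pullE -fE.
Qed.

(** In the opposite category the claim is about products of spaces. For uniqueness, two candidates
    take predicates on S as values on the unit interval, and these are determined by their
    components. *)
Lemma pred_functor_coproducts : preserves_countable_coproducts pred_functor.
Proof.
move=> J B S k kP X f; have [h hE] := pred_tuple_exists f kP.
exists h; split=> // h' h'E; apply: bous_hom_eq => x x01.
have [p hp] := pemb_surj (bous_hom_interval h x01).
have [q hq] := pemb_surj (bous_hom_interval h' x01).
rewrite hp hq; congr pemb; apply: (coproduct_ext kP) => j.
apply: (@pemb_inj (B j)); rewrite -!pullE -hp -hq.
have := hE j; rewrite -(h'E j) => /(congr1 (fun g : bous_hom _ _ => g x)).
by [].
Qed.

Lemma pred_functor_morphism :
  @is_effectus_morphism C (sigmaBOUSop R) pred_functor.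
Proof.
split; first exact: pred_functor_coproducts.
have [u uE] := unit_hom_exists.
(* In the opposite category [u] is a positive map from the space of the unit object to the real
   line; its inverse sends r to r times the order unit. *)
exists u; split.
  exists (BousHom (real_to_bousP (pred_space I))); split.
    apply: bous_hom_eq => r r01 /=.
    by rewrite /real_to_bous ounit_scale_unit // uE.
  apply: bous_hom_eq => x /scal_of_surj[r r01 ->] /=.
  by rewrite uE // /real_to_bous ounit_scale_unit.
move=> A; apply: bous_hom_eq => x /scal_of_surj[r r01 ->] /=.
by rewrite uE // /real_to_bous ounit_scale // pullE.
Qed.

Definition pred_iso A (p : pred_module theta A) :
  unit_interval_module (pred_functor A) := exist _ (pemb p) (pemb01 p).

Lemma pred_iso_effect A : is_effect_iso (@pred_iso A).
Proof.
split.
- exists (fun x => pemb_inv (val x)) => [p|x]; first exact: pembK.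
  apply: val_inj => /=; have [p xp] := pemb_surj (valP x).
  by rewrite xp pembK.
- move=> p q /=; case e : (padd _ p q) => [c|] /=.
    have pq := pembD e; rewrite insubT ?pq ?pemb01 // => c01.
    by congr Some; apply: val_inj.
  (* An undefined sum of predicates must leave the interval, by [pemb_padd]. *)
  rewrite insubF //; apply/negP => /andP[_ /pemb_padd[c]].
  by rewrite e.
- by apply: val_inj => /=; rewrite -[LHS]/(emb _) [LHS]emb0.
- exact: val_inj.
Qed.

Lemma pred_iso_module A : is_effect_module_iso (@pred_iso A).
Proof.
have iso := pred_iso_effect A; split=> //.
- move=> r p; apply: val_inj => /=; rewrite -pemb_act; last exact: (valP r).
  congr (pemb (theta _ \oc p)); apply: val_inj; rewrite clipK //.
  exact: (valP r).
- by move=> a b; apply: iso_ele.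
- by move=> J x s; apply: iso_ecsum.
Qed.

End Representation.

Unset Implicit Arguments.

Theorem theorem56 (R : realType) (C : sigmaEffectus)
    (theta : unit_interval R -> scalars C)
    (theta_iso : is_effect_monoid_iso theta)
    (C_separated : predicate_separated C) :
  exists F : functor C (sigmaBOUSop R),
    [/\ faithful F,
        @is_effectus_morphism C (sigmaBOUSop R) F
      & forall A : C,
          exists Phi : pred_module theta A -> unit_interval_module (F A),
            is_effect_module_iso Phi].
Proof.
exists (pred_functor theta_iso); split.
- exact: pred_functor_faithful.
- exact: pred_functor_morphism.
- by move=> A; exists (@pred_iso _ _ _ theta_iso A); apply: pred_iso_module.
Qed.
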